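(* The random variable $K_{f_P}$ has, as $N\to\infty$, asymptotically (a) a standard normal distribution if and only if $\beta_1\to 0$; (b) a standardized $\chi^2_1$ distribution, i.e. the distribution of $(\chi_1^2-1)/\sqrt2$, if and only if $\beta_1\to 1$.
   Context: For each $N$ let $a\in\mathbb N$ groups with dimensions $d_1,\dots,d_a$ and sample sizes $n_1,\dots,n_a$ be given, $N=\sum_{i=1}^a n_i$, $D=\sum_{i=1}^a d_i$, with positive definite covariance matrices $\Sigma_i\in\mathbb R^{d_i\times d_i}$; put $V_N=\bigoplus_{i=1}^a\frac{N}{n_i}\Sigma_i$ (block diagonal), and let $T\in\mathbb R^{D\times D}$ be a nonzero symmetric idempotent matrix. All these quantities may depend on $N$. Let $\lambda_1\ge\dots\ge\lambda_D$ be the eigenvalues of $TV_NT$ and $\beta_1=\lambda_1/\sqrt{\sum_{\ell=1}^D\lambda_\ell^2}$. For real $f>0$ let $K_f=(\chi_f^2-f)/\sqrt{2f}$, where $\chi_f^2$ denotes a random variable with chi-squared distribution with $f$ degrees of freedom. The degrees of freedom used are $$f_P=\frac{\operatorname{tr}^3\big((TV_N)^2\big)}{\operatorname{tr}^2\big((TV_N)^3\big)},$$ where $\operatorname{tr}^k(M)=(\operatorname{tr}M)^k$. ''Asymptotically has distribution $F$'' means convergence in distribution to $F$ as $N\to\infty$. *)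

(* Defs.v *)
From HB Require Import structures.
From mathcomp Require Import all_boot all_order all_algebra.
From mathcomp Require Import all_classical all_reals all_analysis.
From mathcomp Require Import measurable_realfun.

Set Implicit Arguments.
Unset Strict Implicit.
Unset Printing Implicit Defensive.

Import Order.TTheory GRing.Theory Num.Theory.
Import numFieldNormedType.Exports.

Local Open Scope classical_set_scope.
Local Open Scope ring_scope.

Section gamma_function.
Context {R : realType}.
Notation mu := (@lebesgue_measure R).

Definition gamma_integrand (s t : R) : R := t `^ (s - 1) * expR (- t).

Definition Gamma (s : R) : R := \int[mu]_(t in `]0, +oo[) gamma_integrand s t.

End gamma_function.

Section chi_square_pdf.
Context {R : realType}.

Definition chi_square_fun (f x : R) : R := x `^ (f / 2 - 1) * expR (- (x / 2)).

(* As for normal_pdf, a parameter outside the intended range (f <= 0) is sent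
   to the uniform density on [0, 1], so that a probability is always obtained. *)
Definition chi_square_pdf (f x : R) : R :=
  if 0 < f then
    if 0 < x then chi_square_fun f x / (2 `^ (f / 2) * Gamma (f / 2)) else 0
  else \1_`[0, 1] x.

Definition chi_square_prob (f : R) : set R -> \bar R :=
  fun V => (\int[lebesgue_measure]_(x in V) (chi_square_pdf f x)%:E)%E.

End chi_square_pdf.

Section gamma_theory.
Context {R : realType}.
Notation mu := (@lebesgue_measure R).
Implicit Types s t x : R.

Lemma measurable_gamma_integrand s :
  measurable_fun [set: R] (gamma_integrand s).
Proof.
apply: measurable_funM; first exact: measurable_powR.
exact: measurableT_comp.
Qed.

Lemma gamma_integrand_ge0 s t : 0 <= gamma_integrand s t.
Proof. by rewrite mulr_ge0 ?powR_ge0 ?expR_ge0. Qed.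

Lemma gamma_integrand_gt0 s t : 0 < t -> 0 < gamma_integrand s t.
Proof. by move=> t0; rewrite mulr_gt0 ?powR_gt0 ?expR_gt0. Qed.

Lemma bigcup_itv0y (c : R) : 0 < c ->
  `]0, +oo[%classic = \bigcup_n `[c * n.+1%:R^-1, +oo[%classic.
Proof.
move=> c0; apply/seteqP; split => x /=.
  rewrite in_itv/= andbT => x0; exists (Num.truncn (x / c)^-1) => //=.
  rewrite in_itv/= andbT -ler_pdivlMl// (mulrC c^-1) invf_ple ?posrE ?divr_gt0//.
  by rewrite ltW// truncnS_gt.
move=> [n _] /=; rewrite !in_itv/= !andbT; apply: lt_le_trans.
by rewrite mulr_gt0// invr_gt0.
Qed.

Lemma bigcup_itv01 :
  `]0, 1]%classic = \bigcup_n `[(n.+1%:R^-1 : R), 1]%classic.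
Proof.
apply/seteqP; split => x /=.
  rewrite in_itv/= => /andP[x0 x1].
  have : `]0, +oo[%classic x by rewrite /= in_itv/= x0.
  rewrite (bigcup_itv0y ltr01) => -[n _] /=; rewrite mul1r in_itv/= andbT => nx.
  by exists n => //=; rewrite in_itv/= nx.
move=> [n _] /=; rewrite !in_itv/= => /andP[nx ->]; rewrite andbT.
by apply: lt_le_trans nx; rewrite invr_gt0.
Qed.

Lemma continuous_powR_gt0 s x : 0 < x -> continuous_at x (fun y : R => y `^ s).
Proof.
move=> x0; apply: differentiable_continuous; apply/derivable1_diffP.
by apply: derivable_powR; rewrite in_itv/= x0.
Qed.

Lemma within_continuous_gt0 (h : R -> R) (A : set R) :
  (forall x, 0 < x -> continuous_at x h) -> A `<=` `]0, +oo[ ->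
  {within A, continuous h}.
Proof.
move=> ch A0; apply: continuous_in_subspaceT => x /set_mem /A0 /=.
by rewrite in_itv/= andbT => /ch.
Qed.

Lemma integral_powR_01 s : 0 < s ->
  (\int[mu]_(t in `]0%R, 1%R]) (t `^ (s - 1))%:E <= (s^-1)%:E)%E.
Proof.
move=> s0; rewrite bigcup_itv01.
have cv := @ge0_nondecreasing_set_cvg_integral _ (measurableTypeR R) R
  (fun n => `[(n.+1%:R^-1 : R), 1]%classic) (fun t => (t `^ (s - 1))%:E) mu.
rewrite -(cvg_lim _ (cv _ _ _ _))//; last 3 first.
- apply/nondecreasing_seqP => n; apply/subsetPset => x /=.
  rewrite !in_itv/= => /andP[nx ->]; rewrite andbT.
  by apply: le_trans nx; rewrite lef_pV2 ?posrE// ler_nat.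
- move=> i; apply/measurable_EFinP; apply: measurable_funTS.
  exact: measurable_powR.
- by move=> i x _; rewrite lee_fin powR_ge0.
apply: lime_le.
  apply: ereal_nondecreasing_is_cvgn.
  apply: ge0_nondecreasing_set_nondecreasing_integral => //.
  - apply/nondecreasing_seqP => n; apply/subsetPset => x /=.
    rewrite !in_itv/= => /andP[nx ->]; rewrite andbT.
    by apply: le_trans nx; rewrite lef_pV2 ?posrE// ler_nat.
  - move=> i; apply/measurable_EFinP; apply: measurable_funTS.
    exact: measurable_powR.
  - by move=> i x _; rewrite lee_fin powR_ge0.
near=> n.
have n1 : (n.+1%:R^-1 : R) < 1.
  by rewrite invf_lt1// ltr1n ltnS; near: n; exact: nbhs_infty_gt.
have n0 : 0 < (n.+1%:R^-1 : R) by rewrite invr_gt0.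
rewrite (@continuous_FTC2 _ _ (fun t => s^-1 * t `^ s))//.
- rewrite powR1 mulr1 -EFinB lee_fin gerBl mulr_ge0 ?powR_ge0//.
  by rewrite invr_ge0 ltW.
- apply: within_continuous_gt0 => [x|x /=]; first exact: continuous_powR_gt0.
  by rewrite !in_itv/= => /andP[nx _]; rewrite andbT (lt_le_trans n0).
- split.
  + move=> x; rewrite in_itv/= => /andP[nx _].
    apply: derivableM => //; apply: derivable_powR.
    by rewrite in_itv/= andbT (lt_trans n0).
  + apply: cvgMr; apply: cvg_at_right_filter.
    exact: continuous_powR_gt0.
  + apply: cvgMr; apply: cvg_at_left_filter.
    exact: continuous_powR_gt0.
- move=> x; rewrite in_itv/= => /andP[nx _].
  have x0 : 0 < x by rewrite (lt_trans n0).
  rewrite derive1E deriveMl; last first.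
    by apply: derivable_powR; rewrite in_itv/= x0.
  rewrite -derive1E powR_derive1 ?in_itv/= ?x0//.
  by rewrite mulrA mulVf ?mul1r// gt_eqF.
Unshelve. all: by end_near. Qed.

Lemma gamma_integrand_le1y s : exists C : R,
  forall t, 1 <= t -> gamma_integrand s t <= C * expR (- (t / 2)).
Proof.
pose k := (Num.truncn `|s - 1|).+1.
exists (k`!%:R * 2 ^+ k) => t t1.
have t0 : 0 <= t by rewrite (le_trans _ t1).
have tk : t `^ (s - 1) <= t ^+ k.
  rewrite -powR_mulrn// ler_powR//.
  by apply: le_trans (ler_norm _) _; apply: ltW; exact: truncnS_gt.
have kt : t ^+ k <= k`!%:R * 2 ^+ k * expR (t / 2).
  have := @expR_ge1Dxn R (t / 2) k.-1; rewrite divr_ge0//= => /(_ erefl) h.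
  have {h} : (t / 2) ^+ k / k`!%:R <= expR (t / 2).
    by rewrite (le_trans _ h)// lerDr.
  rewrite ler_pdivrMr ?ltr0n ?fact_gt0// expr_div_n.
  by rewrite ler_pdivrMr ?exprn_gt0// -mulrA [in X in X -> _]mulrC.
rewrite /gamma_integrand.
have -> : expR (- t) = expR (- (t / 2)) * expR (- (t / 2)).
  by rewrite -expRD -opprD -splitr.
rewrite mulrA ler_pM2r ?expR_gt0//.
rewrite expRN ler_pdivrMr ?expR_gt0//.
exact: le_trans tk kt.
Qed.

Lemma integral_gamma_integrand_lty s : 0 < s ->
  (\int[mu]_(t in `]0%R, +oo[) (gamma_integrand s t)%:E < +oo)%E.
Proof.
move=> s0.
have mg (A : set R) : measurable_fun A (fun t => (gamma_integrand s t)%:E).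
  apply/measurable_EFinP; apply: measurable_funTS.
  exact: measurable_gamma_integrand.
have -> : `]0, +oo[%classic = `]0, 1]%classic `|` `](1 : R), +oo[%classic.
  by rewrite -(@itv_bndbnd_setU _ _ (BRight 0) (BRight 1) (BInfty _ false))// bnd_simp.
rewrite ge0_integral_setU//=; last 3 first.
- exact: mg.
- by move=> t _; rewrite lee_fin gamma_integrand_ge0.
- apply/disj_setPRL => t /=; rewrite !in_itv/= andbT => t1.
  by apply/negP; rewrite negb_and -!ltNge t1 orbT.
apply: lte_add_pinfty.
  apply: (@le_lt_trans _ _ (s^-1)%:E); last exact: ltry.
  apply: le_trans (integral_powR_01 s0).
  apply: ge0_le_integral => //=.
  - by move=> t _; rewrite lee_fin gamma_integrand_ge0.
  - exact: mg.
  - apply/measurable_EFinP; apply: measurable_funTS; exact: measurable_powR.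
  - move=> t; rewrite inE/= => /andP[+ _]; rewrite bnd_simp => t0; rewrite lee_fin.
    by rewrite ler_piMr ?powR_ge0// expR_le1// oppr_le0 ltW.
have [C hC] := gamma_integrand_le1y s.
have C0 : 0 <= C.
  have := le_trans (gamma_integrand_ge0 s 1) (hC 1 (lexx _)).
  by rewrite pmulr_lge0// expR_gt0.
have := @integral_exponential_pdf R 2^-1; rewrite invr_gt0 ltr0n => /(_ erefl) e1.
apply: (@le_lt_trans _ _ (\int[mu]_t ((C * 2)%:E * (exponential_pdf 2^-1 t)%:E))%E).
  rewrite integral_mkcond; apply: ge0_le_integral => //=.
  - by move=> t _; apply: erestrict_ge0 => u _; rewrite lee_fin gamma_integrand_ge0.
  - by apply/(measurable_restrictT (fun t => (gamma_integrand s t)%:E)) => //; exact: mg.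
  - apply/measurable_EFinP; apply: measurable_funM => //.
    exact: measurable_exponential_pdf.
  - move=> t _; rewrite patchE; case: ifPn => [/set_mem/=|_].
      rewrite in_itv/= andbT => t1; rewrite -EFinM lee_fin.
      rewrite exponential_pdfE; last by rewrite (le_trans _ (ltW t1)).
      rewrite -mulrA (mulrA 2) mulfV// mul1r mulNr (mulrC _ t).
      exact/hC/ltW.
    rewrite -EFinM lee_fin mulr_ge0 ?mulr_ge0//.
    by rewrite exponential_pdf_ge0// invr_ge0.
rewrite ge0_integralZl//; last 3 first.
- by apply/measurable_EFinP; exact: measurable_exponential_pdf.
- by move=> t _; rewrite lee_fin exponential_pdf_ge0// invr_ge0.
- by rewrite lee_fin mulr_ge0.
by rewrite e1 mule1 ltry.
Qed.

Lemma GammaE s : 0 < s ->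
  ((Gamma s)%:E = \int[mu]_(t in `]0%R, +oo[) (gamma_integrand s t)%:E)%E.
Proof.
move=> s0; rewrite /Gamma /Rintegral fineK// ge0_fin_numE.
  exact: integral_gamma_integrand_lty.
by apply: integral_ge0 => t _; rewrite lee_fin gamma_integrand_ge0.
Qed.

Lemma gamma_integrand_ge12 s t : 0 < s -> 1 <= t -> t <= 2 ->
  expR (- 2) / 2 <= gamma_integrand s t.
Proof.
move=> s0 t1 t2; have t0 : 0 < t by rewrite (lt_le_trans _ t1).
rewrite mulrC ler_pM ?invr_ge0 ?expR_ge0//; last by rewrite ler_expR lerN2.
apply: (@le_trans _ _ (t `^ (- 1))).
  by rewrite (powR_inv1 (ltW t0)) lef_pV2 ?posrE.
by rewrite ler_powR// lerBrDr addrC subrr; exact: ltW.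
Qed.

Lemma Gamma_gt0 s : 0 < s -> 0 < Gamma s.
Proof.
move=> s0; rewrite -lte_fin GammaE//.
have mg (A : set R) : measurable_fun A (fun t => (gamma_integrand s t)%:E).
  apply/measurable_EFinP; apply: measurable_funTS.
  exact: measurable_gamma_integrand.
apply: (@lt_le_trans _ _ (\int[mu]_(t in `[1%R, 2%R]) (expR (- 2) / 2)%:E)%E).
  rewrite integral_cst//= lebesgue_measure_itv/= lte_fin ltr1n/= -EFinB.
  by rewrite -EFinM lte_fin mulr_gt0 ?divr_gt0 ?expR_gt0// subr_gt0 ltr1n.
apply: (@le_trans _ _ (\int[mu]_(t in `[1%R, 2%R]) (gamma_integrand s t)%:E)%E).
  apply: ge0_le_integral => //=.
  - exact: mg.
  - move=> t; rewrite inE/= => /andP[]; rewrite !bnd_simp => t1 t2.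
    by rewrite lee_fin; exact: gamma_integrand_ge12.
apply: ge0_subset_integral => //=.
- exact: mg.
- by move=> t _; rewrite lee_fin gamma_integrand_ge0.
- move=> t /=; rewrite !in_itv/= andbT => /andP[t1 _].
  by rewrite (lt_le_trans _ t1).
Qed.

Lemma measurable_chi_square_fun (f : R) :
  measurable_fun [set: R] (chi_square_fun f).
Proof.
apply: measurable_funM; first exact: measurable_powR.
by apply: measurableT_comp => //; apply: measurableT_comp => //;
  exact: measurable_funM.
Qed.

Lemma chi_square_fun_ge0 (f x : R) : 0 <= chi_square_fun f x.
Proof. by rewrite mulr_ge0 ?powR_ge0 ?expR_ge0. Qed.

Lemma continuous_chi_square_fun (f x : R) : 0 < x ->
  continuous_at x (chi_square_fun f).
Proof.
move=> x0; apply: cvgM; first exact: continuous_powR_gt0.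
apply: continuous_comp; last exact: continuous_expR.
apply: (@cvgN _ R^o); apply: cvgMl; exact: cvg_id.
Qed.

Lemma chi_square_fun_substitution (f t : R) : 0 < f -> 0 < t ->
  chi_square_fun f (2 * t) * 2 = 2 `^ (f / 2) * gamma_integrand (f / 2) t.
Proof.
move=> f0 t0; rewrite /chi_square_fun /gamma_integrand powRM ?ltW//.
rewrite (mulrC 2 t) mulfK// -(@mulr_powRB1 _ 2 (f / 2)) ?divr_gt0//.
by rewrite mulrC !mulrA.
Qed.

Lemma integral_chi_square_fun_itvcy (f a : R) : 0 < f -> 0 < a ->
  (\int[mu]_(x in `[(2 * a)%R, +oo[) (chi_square_fun f x)%:E =
   \int[mu]_(x in `[a, +oo[)
     (2 `^ (f / 2) * gamma_integrand (f / 2) x)%:E)%E.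
Proof.
move=> f0 a0.
have dF : (fun x : R => 2 * x)^`()%classic = cst 2.
  by apply/funext => x; rewrite derive1E deriveM// derive_cst scaler0 addr0
    derive_id scaler1.
rewrite (@increasing_ge0_integration_by_substitutiony _ (fun x => 2 * x))//.
- apply: eq_integral => x; rewrite inE/= in_itv/= andbT => ax; congr EFin.
  rewrite fctE/= dF/= -chi_square_fun_substitution//.
  exact: lt_le_trans ax.
- by move=> x y _ _ xy; rewrite ltr_pM2l.
- by rewrite dF => ? _; exact: cvg_cst.
- by rewrite dF; exact: is_cvg_cst.
- by rewrite dF; exact: is_cvg_cst.
- split; first by move=> x _; apply: derivableM.
  by apply: cvg_at_right_filter; apply: cvgMr; exact: cvg_id.
- by apply: gt0_cvgMry => //; exact: cvg_id.
- apply: within_continuous_gt0 => [x|x /=]; first exact: continuous_chi_square_fun.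
  by rewrite !in_itv/= !andbT; apply: lt_le_trans; rewrite mulr_gt0.
- by move=> x _; exact: chi_square_fun_ge0.
Qed.

Lemma cvg_integral_itv0y (h : R -> R) (c : R) : 0 < c ->
  measurable_fun setT h -> (forall x, 0 <= h x) ->
  ((fun n => \int[mu]_(x in `[(c * n.+1%:R^-1)%R, +oo[) (h x)%:E) @ \oo -->
   \int[mu]_(x in `]0%R, +oo[) (h x)%:E)%E.
Proof.
move=> c0 mh h0; rewrite (bigcup_itv0y c0).
apply: (@ge0_nondecreasing_set_cvg_integral _ (measurableTypeR R) R
  (fun n => `[c * n.+1%:R^-1, +oo[%classic) (fun x => (h x)%:E)).
- apply/nondecreasing_seqP => n; apply/subsetPset => x /=.
  rewrite !in_itv/= !andbT; apply: le_trans.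
  by rewrite ler_pM2l// lef_pV2 ?posrE// ler_nat.
- by [].
- by move=> i; apply/measurable_EFinP; exact: measurable_funTS.
- by move=> i x _; rewrite lee_fin.
Qed.

Lemma integral_chi_square_fun (f : R) : 0 < f ->
  (\int[mu]_(x in `]0%R, +oo[) (chi_square_fun f x)%:E =
   (2 `^ (f / 2) * Gamma (f / 2))%:E)%E.
Proof.
move=> f0; rewrite EFinM GammaE ?divr_gt0//.
rewrite -ge0_integralZl//; last 2 first.
- apply/measurable_EFinP; apply: measurable_funTS.
  exact: measurable_gamma_integrand.
- by move=> x _; rewrite lee_fin gamma_integrand_ge0.
under [RHS]eq_integral do rewrite -EFinM.
have := @cvg_integral_itv0y (chi_square_fun f) 2 (ltr0Sn _ _)
  (measurable_chi_square_fun f) (chi_square_fun_ge0 f).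
have mg : measurable_fun setT
    (fun x => 2 `^ (f / 2) * gamma_integrand (f / 2) x).
  by apply: measurable_funM => //; exact: measurable_gamma_integrand.
have g0 x : 0 <= 2 `^ (f / 2) * gamma_integrand (f / 2) x.
  by rewrite mulr_ge0 ?powR_ge0 ?gamma_integrand_ge0.
have := cvg_integral_itv0y ltr01 mg g0.
move=> cr cl.
have E : (fun n => \int[mu]_(x in `[(2 * n.+1%:R^-1)%R, +oo[)
      (chi_square_fun f x)%:E)%E =
    (fun n => \int[mu]_(x in `[(1 * n.+1%:R^-1)%R, +oo[)
      (2 `^ (f / 2) * gamma_integrand (f / 2) x)%:E)%E.
  by apply/funext => n; rewrite mul1r integral_chi_square_fun_itvcy ?invr_gt0.
by move: cl; rewrite E => cl; exact: (cvg_unique _ cl cr).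
Qed.

End gamma_theory.

Section chi_square_prob_theory.
Context {R : realType}.
Notation mu := (@lebesgue_measure R).
Variable f : R.

Lemma chi_square_pdf_ge0 x : 0 <= chi_square_pdf f x.
Proof.
rewrite /chi_square_pdf; case: ifPn => // f0; case: ifPn => // x0.
apply: divr_ge0; first exact: chi_square_fun_ge0.
apply: mulr_ge0; first exact: powR_ge0.
by apply/ltW/Gamma_gt0/divr_gt0.
Qed.

Lemma chi_square_pdfE : 0 < f ->
  chi_square_pdf f =
  (fun x => chi_square_fun f x / (2 `^ (f / 2) * Gamma (f / 2))) \_ `]0, +oo[.
Proof.
move=> f0; apply/funext => x; rewrite /chi_square_pdf f0 patchE.
by rewrite mem_setE in_itv/= andbT.
Qed.

Lemma measurable_chi_square_pdf : measurable_fun [set: R] (chi_square_pdf f).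
Proof.
have [f0|f0] := ltP 0 f; last first.
  rewrite /chi_square_pdf ltNge f0/=; exact: measurable_indic.
rewrite chi_square_pdfE//.
have mh : measurable_fun setT
    (chi_square_fun f \* cst (2 `^ (f / 2) * Gamma (f / 2))^-1).
  apply: measurable_funM; first exact: measurable_chi_square_fun.
  exact: measurable_cst.
apply/(measurable_restrictT
  (chi_square_fun f \* cst (2 `^ (f / 2) * Gamma (f / 2))^-1)) => //.
exact: measurable_funTS.
Qed.

Lemma integral_chi_square_pdf : (\int[mu]_x (chi_square_pdf f x)%:E = 1)%E.
Proof.
have [f0|f0] := ltP 0 f; last first.
  rewrite /chi_square_pdf ltNge f0/= integral_indic//= setIT.
  by rewrite lebesgue_measure_itv/= lte01 oppr0 adde0.
rewrite chi_square_pdfE//; set c := 2 `^ (f / 2) * Gamma (f / 2).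
have c0 : 0 < c.
  by apply: mulr_gt0; [exact: powR_gt0|apply: Gamma_gt0; exact: divr_gt0].
transitivity (\int[mu]_(x in `]0%R, +oo[)
    ((chi_square_fun f x)%:E * c^-1%:E))%E.
  rewrite [RHS]integral_mkcond; apply: eq_integral => x _.
  by rewrite !patchE; case: ifP.
rewrite ge0_integralZr//=; last 3 first.
- apply/measurable_EFinP; apply: measurable_funTS.
  exact: measurable_chi_square_fun.
- by move=> x _; rewrite lee_fin chi_square_fun_ge0.
- by rewrite lee_fin invr_ge0 ltW.
by rewrite (integral_chi_square_fun f0) -EFinM divff// gt_eqF.
Qed.

Local Notation chi_square := (chi_square_prob f).

Let chi_square0 : chi_square set0 = 0%E.
Proof. by rewrite /chi_square_prob integral_set0. Qed.

Let chi_square_ge0 A : (0 <= chi_square A)%E.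
Proof. by apply: integral_ge0 => x _; rewrite lee_fin chi_square_pdf_ge0. Qed.

Let chi_square_sigma_additive : semi_sigma_additive chi_square.
Proof.
move=> /= F mF tF mUF; rewrite /chi_square_prob; apply: cvg_toP.
  apply: ereal_nondecreasing_is_cvgn => m n mn.
  apply: lee_sum_nneg_natr => // k _ _; apply: integral_ge0 => /= x _.
  by rewrite lee_fin chi_square_pdf_ge0.
rewrite ge0_integral_bigcup//=.
- apply/measurable_funTS/measurableT_comp => //.
  exact: measurable_chi_square_pdf.
- by move=> x _; rewrite lee_fin chi_square_pdf_ge0.
Qed.

HB.instance Definition _ := isMeasure.Build _ _ _
  chi_square chi_square0 chi_square_ge0 chi_square_sigma_additive.

Let chi_square_setT : chi_square [set: R] = 1%E.
Proof. exact: integral_chi_square_pdf. Qed.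

HB.instance Definition _ :=
  @Measure_isProbability.Build _ _ R chi_square chi_square_setT.

End chi_square_prob_theory.

Section standardized_chi_square.
Context {R : realType}.
Variable f : R.

(* K_f is chi_standardize f composed with a chi-square variable. *)
Definition chi_standardize (x : R) : R := (x - f) / Num.sqrt (2 * f).

Let measurable_chi_standardize : measurable_fun [set: R] chi_standardize.
Proof. by apply: measurable_funM => //; exact: measurable_funB. Qed.

HB.instance Definition _ := isMeasurableFun.Build _ _ _ _
  chi_standardize measurable_chi_standardize.

End standardized_chi_square.

Section convergence_in_distribution.
Context {R : realType}.

(* Equality is required on measurable sets only: a distribution is a
   pushforward, which is not determined by the law on other sets. *)
Definition has_law d (T : measurableType d) (P : probability T R)
    (X : {RV P >-> R}) (Q : set R -> \bar R) : Prop :=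
  forall A : set R, measurable A -> distribution P X A = Q A.

(* Convergence of the distribution functions at every continuity point of the
   limit; the X_N may live on different probability spaces. *)
Definition cvg_in_distribution (d : nat -> measure_display)
    (T : forall N, measurableType (d N)) (P : forall N, probability (T N) R)
    (X : forall N, {RV (P N) >-> R})
    (Q : set R -> \bar R) : Prop :=
  forall x : R, continuous_at x (fun y : R => Q `]-oo, y]%classic) ->
    cdf (X N) x @[N --> \oo] --> Q `]-oo, x]%classic.

End convergence_in_distribution.

Section matrices.
Context {R : realType}.

Definition posdefmx (k : nat) (S : 'M[R]_k) : Prop :=
  S^T = S /\ forall v : 'cV[R]_k, v != 0 -> 0 < (v^T *m S *m v) ord0 ord0.

(* s lists the eigenvalues of A with their algebraic multiplicities, in
   nonincreasing order. *)
Definition ordered_eigenvalues (k : nat) (A : 'M[R]_k) (s : seq R) : Prop :=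
  sorted >=%R s /\ char_poly A = \prod_(x <- s) ('X - x%:P).

Definition block_covariance (N a : nat) (d n : 'I_a -> nat)
    (Sigma : forall i, 'M[R]_(d i)) : 'M[R]_(\sum_(i < a) d i) :=
  \mxdiag_(i < a) ((N%:R / (n i)%:R) *: Sigma i).

Definition fP (k : nat) (T V : 'M[R]_k) : R :=
  (\tr ((T *m V) ^+ 2)) ^+ 3 / (\tr ((T *m V) ^+ 3)) ^+ 2.

(* s is the nonincreasing list of the eigenvalues, hence s`_0 is lambda_1. *)
Definition beta1 (s : seq R) : R := s`_0 / Num.sqrt (\sum_(x <- s) x ^+ 2).

End matrices.

(* Main.v *)
Require Import Defs.
From HB Require Import structures.
From mathcomp Require Import all_boot all_order all_algebra.
From mathcomp Require Import all_classical all_reals all_analysis.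
From mathcomp Require Import measurable_realfun.
From mathcomp Require Import ring lra.
Import Order.TTheory GRing.Theory Num.Theory.
Import numFieldNormedType.Exports.
Local Open Scope classical_set_scope.
Local Open Scope ring_scope.

(** Write b_i = lambda_i / sqrt (sum of the lambda_l ^ 2), so that the b_i are
    nonnegative, their squares sum to 1 and beta_1 is the largest of them.  As
    T is idempotent, tr ((TV)^k) = tr ((TVT)^k) is the k-th power sum of the
    lambda_i, hence f_P = 1 / (sum of the b_i ^ 3)^2.  The cubes sum to at least
    beta_1 ^ 3 and to at most beta_1, so
      beta_1 ^ -2 <= f_P <= beta_1 ^ -6     with 0 < beta_1 <= 1
    ([fP_beta1_bounds]).  Consequently f_P >= 1, f_P tends to infinity exactly
    when beta_1 tends to 0, and f_P tends to 1 exactly when beta_1 tends to 1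
    ([df_pinfty], [df_to1]).  What remains concerns the one-parameter family of
    distribution functions F_f of K_f for f >= 1.

    Direct implications.  For f tending to infinity, the substitution
    y = f + sqrt (2f) t turns the chi-square density, up to a constant factor,
    into a function of t that converges to exp (- t^2 / 2) under an integrable
    majorant ([gamma_shape_cvg], [gamma_shape_le_majorant]).  A distribution
    function is the quotient of a partial integral of such an unnormalised
    density by its total integral, and dominated convergence applies to both
    ([cvg_normalized_cdf]); the constant factor, which contains the Gamma
    function, cancels in the quotient.  For f tending to a finite limit the same
    quotient is used with the original, unscaled density ([std_chi_cdf_cvg]).

    Converse implications.  The support of K_f is the half-line from
    - sqrt (f / 2) on.  If F_f tends to the normal distribution function, which
    is positive everywhere, then F_f (- sqrt (A / 2)) is eventually positive
    for every A, and so f > A eventually ([std_chi_cdf_pinfty]).  If F_f tends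
    to F_1, take e > 0 and x = - sqrt ((1 + e / 2) / 2), which lies below the
    support of K_1: F_f (x) tends to 0.  But f |-> F_f (x) is continuous and
    positive on the half-line from 1 + e on, with a positive limit at infinity,
    so it has a positive lower bound there, and f < 1 + e eventually
    ([std_chi_cdf_ge_away], [std_chi_cdf_to1]). *)

(** * Power sums of eigenvalues as traces *)

(** A change of basis over F is also one over the polynomials over F, where it
    carries the characteristic matrix of A to that of the conjugate. *)
Lemma char_poly_conj (F : fieldType) (n : nat) (P A : 'M[F]_n) :
  P \in unitmx -> char_poly (P *m A *m invmx P) = char_poly A.
Proof.
move=> uP; rewrite /char_poly.
have -> : char_poly_mx (P *m A *m invmx P) =
    map_mx polyC P *m char_poly_mx A *m map_mx polyC (invmx P).
  rewrite /char_poly_mx mulmxBr mulmxBl -!map_mxM; congr (_ - _).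
  by rewrite scalar_mxC -mulmxA -map_mxM mulmxV// map_mx1 mulmx1.
rewrite !det_mulmx mulrAC -det_mulmx -map_mxM mulmxV//.
by rewrite map_mx1 det1 mul1r.
Qed.

Lemma mxtrace_conj_exp (F : fieldType) (n k : nat) (P A : 'M[F]_n) :
  P \in unitmx -> \tr ((P *m A *m invmx P) ^+ k) = \tr (A ^+ k).
Proof.
move=> uP; have -> : (P *m A *m invmx P) ^+ k = P *m A ^+ k *m invmx P.
  elim: k => [|k IH]; first by rewrite !expr0 mulmx1 mulmxV.
  by rewrite !exprS IH -!mulmxE !mulmxA mulmxKV.
by rewrite mxtrace_mulC mulKmx.
Qed.

(** Basis completion, used to move an eigenvector to the first row. *)
Lemma unitmx_row0 (F : fieldType) (m : nat) (v : 'rV[F]_m.+1) :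
  v != 0 -> exists2 P : 'M[F]_m.+1, P \in unitmx & row 0 P = v.
Proof.
move=> v0.
have h : \rank ((delta_mx 0 0 : 'rV[F]_m.+1) *m (\matrix_(i < m.+1) v)) =
    \rank (delta_mx 0 0 : 'rV[F]_m.+1).
  by rewrite -rowE rowK mxrank_delta rank_rV v0.
have [P uP] := complete_unitmx h.
by rewrite -!rowE rowK => vP; exists P.
Qed.

(** Induction on the eigenvalues: in a basis starting with an eigenvector for x
    the matrix is block triangular with diagonal blocks x and D, the
    characteristic polynomial of D is the product of the remaining factors, and
    the powers stay block triangular with diagonal blocks x ^ k and D ^ k. *)
Lemma mxtrace_exp_char_poly (F : fieldType) (s : seq F) (n k : nat)
    (A : 'M[F]_n) :
  char_poly A = \prod_(x <- s) ('X - x%:P) ->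
  \tr (A ^+ k) = \sum_(x <- s) x ^+ k.
Proof.
elim: s n A => [|x s IH] n A cA.
  have := size_char_poly A; rewrite cA big_nil size_poly1 => -[n0].
  by move: A cA; rewrite -n0 => A _; rewrite big_nil /mxtrace big_ord0.
have := size_char_poly A; rewrite cA big_cons size_monicM ?monicXsubC//;
  last by rewrite monic_neq0// monic_prod// => i _; exact: monicXsubC.
rewrite size_prod_XsubC size_XsubC /= => -[sn].
move: A cA; rewrite -{n}sn; set m := size s => A cA.
have : eigenvalue A x by rewrite eigenvalue_root_char cA big_cons rootM root_XsubC eqxx.
case/eigenvalueP => v vA v0.
have [P uP Pv] := unitmx_row0 _ _ _ v0.
have row0 : row 0 (P *m A *m invmx P) = x *: row 0 1%:M.
  by rewrite !row_mul Pv vA -scalemxAl -Pv -row_mul mulmxV.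
rewrite -(mxtrace_conj_exp _ _ k P A uP).
rewrite -(char_poly_conj _ _ P A uP) in cA.
move: row0 cA; move: (P *m A *m invmx P) => B row0 cA.
pose B' : 'M[F]_(1 + m) := B.
have eB : B' = block_mx x%:M 0 (dlsubmx B') (drsubmx B').
  rewrite -[LHS]submxK; congr (block_mx _ _ _ _).
    apply/matrixP => i j; rewrite !ord1 !mxE eqxx/=.
    have /rowP/(_ 0) := row0; rewrite !mxE eqxx mulr1 => <-.
    by congr (B _ _); apply: val_inj.
  apply/matrixP => i j; rewrite !ord1 !mxE.
  have /rowP/(_ (rshift 1 j)) := row0; rewrite !mxE.
  rewrite (_ : (0 == rshift 1 j) = false) ?mulr0 => [<-|]; last exact/eqP.
  by congr (B _ _); apply: val_inj.
move: eB; move: (dlsubmx B') (drsubmx B') => C D eB.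
have cD : char_poly D = \prod_(y <- s) ('X - y%:P).
  (* It suffices to compare after multiplication by the factor of x. *)
  apply: (@mulfI _ ('X - x%:P)); first by rewrite polyXsubC_eq0.
  transitivity (char_poly B'); last by rewrite -[LHS]/(char_poly B) cA big_cons.
  rewrite eB /char_poly /char_poly_mx.
  rewrite map_block_mx map_scalar_mx map_mx0 (@scalar_mx_block _ 1 m).
  rewrite opp_block_mx add_block_mx oppr0 addr0 det_lblock.
  by rewrite -raddfB/= det_scalar1.
have eBk j : exists Cj, B' ^+ j = block_mx (x ^+ j)%:M 0 Cj (D ^+ j).
  elim: j => [|j [Cj IHj]]; first by exists 0; exact: (@scalar_mx_block F 1 m 1).
  exists (C *m (x ^+ j)%:M + D *m Cj); rewrite exprS IHj {1}eB -mulmxE mulmx_block.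
  by rewrite !mulmx0 !mul0mx !addr0 !add0r -scalar_mxM -!exprS [D ^+ j.+1]exprS.
have [Ck eCk] := eBk k; by rewrite -[LHS]/(\tr (B' ^+ k)) eCk
  mxtrace_block (IH _ D cD) big_cons mxtrace_scalar mulr1n.
Qed.

(** All inner occurrences of T T collapse to T, so the k-th power of TVT is that
    of TV followed by T; the last T is absorbed cyclically into the first. *)
Lemma mxtrace_exp_idem (F : fieldType) (n k : nat) (T V : 'M[F]_n) :
  T *m T = T -> \tr ((T *m V *m T) ^+ k.+1) = \tr ((T *m V) ^+ k.+1).
Proof.
move=> TT.
have -> : (T *m V *m T) ^+ k.+1 = (T *m V) ^+ k.+1 *m T.
  elim: k => [|k IH]; first by rewrite !expr1.
  rewrite exprS IH [in RHS]exprS -!mulmxE -!mulmxA; congr (T *m (V *m _)).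
  by rewrite exprS -mulmxE !mulmxA TT.
by rewrite mxtrace_mulC exprS -mulmxE !mulmxA TT.
Qed.

(** * The degrees of freedom and beta_1 *)

Lemma posdefmx_block_covariance (R : realType) (N a : nat) (d n : 'I_a -> nat)
    (Sigma : forall i, 'M[R]_(d i)) :
  (0 < N)%N -> (forall i, 0 < n i)%N -> (forall i, posdefmx (Sigma i)) ->
  posdefmx (block_covariance N n Sigma).
Proof.
move=> N0 n0 S0; rewrite /block_covariance; split.
  rewrite tr_mxdiag; apply/eq_mxdiag => i.
  by rewrite linearZ/= (S0 i).1.
have c0 i : 0 < N%:R / (n i)%:R :> R by rewrite divr_gt0 ?ltr0n.
have Sge0 i (w : 'cV[R]_(d i)) : 0 <= (w^T *m Sigma i *m w) ord0 ord0.
  have [->|w0] := eqVneq w 0; first by rewrite mulmx0 mxE.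
  exact/ltW/(S0 i).2.
move=> v v0; rewrite -(submxcolK v) tr_mxcol -mulmxA mul_mxdiag_mxcol.
rewrite mul_mxrow_mxcol summxE.
have e i : ((submxcol v i)^T *m (N%:R / (n i)%:R *: Sigma i *m submxcol v i))
    ord0 ord0 =
    N%:R / (n i)%:R * ((submxcol v i)^T *m Sigma i *m submxcol v i) ord0 ord0.
  by rewrite -scalemxAl -scalemxAr mulmxA mxE.
have [i vi] : exists i, submxcol v i != 0.
  apply/existsP; apply: contraR v0 => /existsPn h.
  apply/eqP; rewrite -(submxcolK v) -[RHS]mxcol0; apply/eq_mxcol => i.
  by apply/eqP; rewrite -[_ == _]negbK h.
rewrite (bigD1 i)//= e; apply: ltr_wpDr.
  by apply: sumr_ge0 => j _; rewrite e mulr_ge0// ltW.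
by rewrite mulr_gt0// (S0 i).2.
Qed.

(** Evaluate the form at an eigenvector v: the value is x times the squared
    norm of v. *)
Lemma eigenvalue_ge0 (R : realType) (k : nat) (A : 'M[R]_k) (x : R) :
  (forall v : 'cV[R]_k, 0 <= (v^T *m A *m v) ord0 ord0) ->
  root (char_poly A) x -> 0 <= x.
Proof.
move=> A0; rewrite -eigenvalue_root_char => /eigenvalueP[v vA v0].
have := A0 v^T; rewrite trmxK vA -scalemxAl mxE.
rewrite pmulr_lge0//.
have E : (v *m v^T) ord0 ord0 = \sum_j v ord0 j ^+ 2.
  by rewrite mxE; apply: eq_bigr => j _; rewrite mxE expr2.
rewrite E lt0r sumr_ge0 ?andbT; last by move=> j _; exact: sqr_ge0.
apply: contra v0 => /eqP/psumr_eq0P h; apply/eqP/rowP => j; rewrite mxE.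
by apply/eqP; rewrite -sqrf_eq0; apply/eqP/h => // i _; exact: sqr_ge0.
Qed.

(** For a symmetric matrix, the trace of the square is the sum of the squared
    entries. *)
Lemma mxtrace_sqr_gt0 (R : realType) (k : nat) (A : 'M[R]_k) :
  A^T = A -> A != 0 -> 0 < \tr (A ^+ 2).
Proof.
move=> sA A0.
have E : \tr (A ^+ 2) = \sum_i \sum_j A i j ^+ 2.
  apply: eq_bigr => i _; rewrite expr2 -mulmxE mxE; apply: eq_bigr => j _.
  by rewrite -{2}sA mxE expr2.
have ge0 i : 0 <= \sum_j A i j ^+ 2 by apply: sumr_ge0 => j _; exact: sqr_ge0.
rewrite E lt0r sumr_ge0// andbT.
apply: contra A0 => /eqP/psumr_eq0P h; apply/eqP/matrixP => i j; rewrite mxE.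
have /psumr_eq0P h' := h (fun i _ => ge0 i) i isT.
by apply/eqP; rewrite -sqrf_eq0; apply/eqP/h' => // l _; exact: sqr_ge0.
Qed.

(** If TVT vanishes, then so does the form of V at every vector T w, so that T w
    vanishes. *)
Lemma compression_neq0 (R : realType) (k : nat) (T V : 'M[R]_k) :
  posdefmx V -> T != 0 -> T^T = T -> T *m V *m T != 0.
Proof.
move=> [_ V0] T0 sT; apply: contra_neq T0 => TVT.
apply/matrixP => i j; rewrite mxE.
(* The form of V is tested on the columns of T. *)
pose v : 'cV[R]_k := T *m delta_mx j 0.
have [v0|v0] := eqVneq v 0.
  by have /colP/(_ i) := v0; rewrite /v -colE !mxE.
have := V0 v v0; rewrite /v trmx_mul sT -!mulmxA (mulmxA T V) (mulmxA (T *m V)).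
by rewrite TVT mul0mx mulmx0 mxE ltxx.
Qed.

Lemma sum_pow_max_bounds (R : realType) (s : seq R) :
  sorted >=%R s -> (forall x, x \in s -> 0 <= x) ->
  0 < \sum_(x <- s) x ^+ 2 ->
  [/\ 0 < s`_0, s`_0 ^+ 2 <= \sum_(x <- s) x ^+ 2,
   s`_0 ^+ 3 <= \sum_(x <- s) x ^+ 3 &
   \sum_(x <- s) x ^+ 3 <= s`_0 * \sum_(x <- s) x ^+ 2].
Proof.
case: s => [|l s]; first by rewrite big_nil ltxx.
move=> /= sl s0 S0.
have ls x : x \in l :: s -> x <= l.
  rewrite inE => /predU1P[->//|].
  have tr : transitive (>=%R : rel R) by move=> a b c h1 h2; exact: le_trans h1.
  by move/(order_path_min tr)/allP : sl => /[apply].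
have l0 : 0 <= l by rewrite s0// mem_head.
have le k : l ^+ k <= \sum_(x <- l :: s) x ^+ k.
  rewrite big_cons lerDl big_seq sumr_ge0// => x xs.
  by rewrite exprn_ge0// s0// inE xs orbT.
have S3 : \sum_(x <- l :: s) x ^+ 3 <= l * \sum_(x <- l :: s) x ^+ 2.
  rewrite mulr_sumr big_seq [leRHS]big_seq; apply: ler_sum => x xs.
  by rewrite exprS ler_wpM2r ?sqr_ge0// ls.
split => //; rewrite lt0r l0 andbT; apply: contraL S0 => /eqP e.
rewrite -leNgt big_seq sumr_le0// => x xs.
have -> : x = 0 by apply/le_anti; rewrite s0// andbT -e ls.
by rewrite expr0n.
Qed.

(** With l the largest eigenvalue and A, B the sums of the squares and cubes,
    f_P beta_1 ^ 2 = (l A / B) ^ 2 and f_P beta_1 ^ 6 = (l ^ 3 / B) ^ 2, while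
    l ^ 3 <= B <= l A. *)
Lemma fP_beta1_bounds (R : realType) (k : nat) (T V : 'M[R]_k) (s : seq R) :
  posdefmx V -> T != 0 -> T^T = T -> T *m T = T ->
  ordered_eigenvalues (T *m V *m T) s ->
  [/\ 0 < beta1 s, beta1 s <= 1, 1 <= fP T V * beta1 s ^+ 2 &
      fP T V * beta1 s ^+ 6 <= 1].
Proof.
move=> pV T0 sT TT [ss cs].
have pA (v : 'cV[R]_k) : 0 <= (v^T *m (T *m V *m T) *m v) ord0 ord0.
  rewrite (_ : _ *m v = (T *m v)^T *m V *m (T *m v)); last first.
    by rewrite trmx_mul sT !mulmxA.
  have [->|v0] := eqVneq (T *m v) 0; first by rewrite mulmx0 mxE.
  exact/ltW/pV.2.
have s0 x : x \in s -> 0 <= x.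
  move=> xs; apply: (@eigenvalue_ge0 _ _ _ x pA).
  by rewrite cs root_prod_XsubC.
have tr2 : \tr ((T *m V) ^+ 2) = \sum_(x <- s) x ^+ 2.
  by rewrite -mxtrace_exp_idem// (mxtrace_exp_char_poly _ s).
have tr3 : \tr ((T *m V) ^+ 3) = \sum_(x <- s) x ^+ 3.
  by rewrite -mxtrace_exp_idem// (mxtrace_exp_char_poly _ s).
have S2 : 0 < \sum_(x <- s) x ^+ 2.
  rewrite -tr2 -mxtrace_exp_idem//; apply: mxtrace_sqr_gt0.
    by rewrite !trmx_mul sT pV.1 mulmxA.
  exact: compression_neq0.
have [] := @sum_pow_max_bounds _ s ss s0 S2.
rewrite /fP tr2 tr3 /beta1; set l := s`_0.
move: (\sum_(x <- s) x ^+ 2) (\sum_(x <- s) x ^+ 3) S2 => A B A0 l0 lA lB BA.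
have B0 : 0 < B by apply: lt_le_trans lB; rewrite exprn_gt0.
have sA : 0 < Num.sqrt A by rewrite sqrtr_gt0.
have sA2 : Num.sqrt A ^+ 2 = A by rewrite sqr_sqrtr// ltW.
split.
- by rewrite divr_gt0.
- rewrite ler_pdivrMr// mul1r -(@ler_pXn2r _ 2%N)// ?nnegrE ?sA2//; exact: ltW.
- rewrite expr_div_n sA2.
  have -> : A ^+ 3 / B ^+ 2 * (l ^+ 2 / A) = (l * A / B) ^+ 2.
    by field; rewrite !gt_eqF.
  by rewrite exprn_ege1// ler_pdivlMr// mul1r.
- rewrite expr_div_n (exprM (Num.sqrt A) 2 3) sA2.
  have -> : A ^+ 3 / B ^+ 2 * (l ^+ 6 / A ^+ 3) = (l ^+ 3 / B) ^+ 2.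
    by field; rewrite !gt_eqF.
  by rewrite exprn_ile1// ?ler_pdivrMr ?mul1r// divr_ge0 ?exprn_ge0// ltW.
Qed.

(** * Dominated convergence of normalised densities *)

(** The measure b times Lebesgue, pushed forward by x |-> c + b x, has the right
    value on intervals and hence is Lebesgue measure. *)
Lemma ge0_integral_affine (R : realType) (b c : R) (D : set R)
    (G : R -> \bar R) :
  0 < b -> measurable D -> measurable_fun [set: R] G -> (forall y, 0 <= G y)%E ->
  (\int[lebesgue_measure]_(y in D) G y =
   b%:E * \int[lebesgue_measure]_(x in [set x | D (c + b * x)%R])
     G (c + b * x)%R)%E.
Proof.
move=> b0 mD mG G0.
pose F (x : R) : measurableTypeR R := c + b * x.
have mF : measurable_fun [set: R] F by apply: measurable_funD => //; exact: measurable_funM.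
pose bp := NngNum (ltW b0).
pose nu := mscale bp (@lebesgue_measure R).
have mlF A : measurable A -> lebesgue_measure A = pushforward nu F A.
  move=> mA.
  apply: (@lebesgue_measure_unique _ (pushforward nu F)) => //= _ [[x y]] _ <-.
  rewrite /pushforward /nu /mscale/=.
  have -> : F @^-1` `]x, y] = `](x - c) / b, (y - c) / b]%classic.
    apply/seteqP; split => t /=; rewrite /F !in_itv/= ltr_pdivrMr// ler_pdivlMr//;
    by rewrite ltrBlDl lerBrDl (mulrC b).
  rewrite !lebesgue_measure_itv/= !lte_fin ltr_pM2r ?invr_gt0// ltrD2r.
  case: ifP => _; last by rewrite mule0.
  by rewrite -!EFinB -EFinM; congr EFin; field; rewrite gt_eqF.
transitivity (\int[pushforward nu F]_(y in D) G y)%E.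
  by apply: eq_measure_integral => //= A mA _; exact: mlF.
rewrite ge0_integral_pushforward//; last exact: measurable_funTS.
have mFD : measurable (F @^-1` D) by rewrite -[X in measurable X]setTI; exact: mF.
apply: (@ge0_integral_mscale _ _ _ lebesgue_measure _ mFD bp (G \o F)) => //.
  by apply: measurable_funTS; exact: measurableT_comp mG mF.
by move=> x _; exact: G0.
Qed.

(** The bound is asked for only eventually, because the majorants used below hold
    only for parameters near their limit. *)
Lemma cvg_Rintegral_dominated (R : realType) (q : nat -> R -> R) (q0 g : R -> R) :
  (forall n, measurable_fun [set: R] (q n)) -> measurable_fun [set: R] q0 ->
  lebesgue_measure.-integrable setT (EFin \o g) ->
  {ae lebesgue_measure, forall t, q n t @[n --> \oo] --> q0 t} ->
  (\forall n \near \oo, forall t, `|q n t| <= g t) ->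
  (\int[lebesgue_measure]_t q n t) @[n --> \oo] -->
  \int[lebesgue_measure]_t q0 t.
Proof.
move=> mq mq0 ig qq [N _ qg].
rewrite -(cvg_shiftn N).
have [] := @dominated_convergence _ _ _ lebesgue_measure setT measurableT
  (fun n t => (q (n + N)%N t)%:E) (EFin \o q0) (EFin \o g).
- by move=> n; apply/measurable_EFinP; exact: mq.
- exact/measurable_EFinP.
- case: qq => Z [mZ Z0 sZ]; exists Z; split => // t /= ht; apply: sZ => /= qt.
  apply: ht => _; apply: cvg_EFin; first exact: nearW.
  by rewrite (cvg_shiftn N (fun n => q n t)).
- exact: ig.
- apply: aeW => t n _; rewrite lee_fin; apply: qg; exact: leq_addl.
move=> iq0 _ cv; apply: fine_cvg; rewrite fineK; first exact: cv.
exact: integrable_fin_num.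
Qed.

(** The distribution function of the law with unnormalised density q. *)
Definition normalized_cdf {R : realType} (q : R -> R) (c : R) : R :=
  (\int[lebesgue_measure]_(t in `]-oo, c]) q t) / \int[lebesgue_measure]_t q t.

(** The end points may move with n because the truncations of q n to the
    half-lines up to c n converge at every point except possibly c0. *)
Lemma cvg_normalized_cdf (R : realType) (q : nat -> R -> R) (q0 g : R -> R)
    (c : nat -> R) (c0 : R) :
  (forall n, measurable_fun [set: R] (q n)) -> measurable_fun [set: R] q0 ->
  lebesgue_measure.-integrable setT (EFin \o g) ->
  (forall t, q n t @[n --> \oo] --> q0 t) ->
  (\forall n \near \oo, forall t, `|q n t| <= g t) ->
  c n @[n --> \oo] --> c0 ->
  \int[lebesgue_measure]_t q0 t != 0 ->
  normalized_cdf (q n) (c n) @[n --> \oo] --> normalized_cdf q0 c0.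
Proof.
move=> mq mq0 ig qq qg cc q00; apply: cvgM; last first.
  apply: cvgV => //; apply: cvg_Rintegral_dominated ig _ qg => //.
  by apply: aeW => t.
under eq_cvg do rewrite Rintegral_mkcond.
rewrite Rintegral_mkcond.
apply: (@cvg_Rintegral_dominated _ _ _ g) => //.
- move=> n; apply/(measurable_restrictT _ _).1 => //; exact: measurable_funTS.
- apply/(measurable_restrictT _ _).1 => //; exact: measurable_funTS.
- exists [set c0]; split => //; first exact: lebesgue_measure_set1.
  move=> t /= qt; apply: contrapT => tc; apply: qt.
  have [tc0|c0t|//] := ltgtP t c0.
    rewrite patchE mem_set; last by rewrite /= in_itv/= ltW.
    apply: cvg_trans (qq t); apply: near_eq_cvg.
    have : \forall n \near \oo, t < c n by exact: cvgr_gt cc _ tc0.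
    apply: filterS => n tn.
    by rewrite patchE mem_set//= in_itv/= ltW.
  rewrite patchE memNset; last by rewrite /= in_itv/=; apply/negP; rewrite -ltNge.
  have cst0 : (fun=> 0 : R) n @[n --> \oo] --> (0 : R) by exact: cvg_cst.
  apply: cvg_trans cst0; apply: near_eq_cvg.
  have : \forall n \near \oo, c n < t by exact: cvgr_lt cc _ c0t.
  apply: filterS => n tn.
  by rewrite patchE memNset//= in_itv/=; apply/negP; rewrite -ltNge.
- apply: filterS qg => n qg t; rewrite patchE; case: ifP => // _.
  by rewrite normr0 (le_trans _ (qg t)).
Qed.

(** This is what makes normalising constants disappear from the limits: p may be
    replaced by any positive multiple q of itself. *)
Lemma normalized_cdf_pdf (R : realType) (p q : R -> R) (k c : R) :
  (forall t, p t = k * q t) -> 0 < k -> measurable_fun [set: R] q ->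
  (forall t, 0 <= q t) ->
  (\int[lebesgue_measure]_t (p t)%:E = 1)%E ->
  \int[lebesgue_measure]_(t in `]-oo, c]) p t = normalized_cdf q c.
Proof.
move=> pq k0 mq q0 p1.
have p0 t : 0 <= p t by rewrite pq mulr_ge0// ltW.
have mp : measurable_fun [set: R] p.
  by rewrite (_ : p = fun t => k * q t); [exact: measurable_funM|exact/funext].
have ip : lebesgue_measure.-integrable setT (EFin \o p).
  apply/integrableP; split; first exact/measurable_EFinP.
  under eq_integral do rewrite gee0_abs ?lee_fin//.
  by rewrite p1 ltry.
have qp : q = fun t => k^-1 * p t.
  by apply/funext => t; rewrite pq mulrA mulVf ?gt_eqF// mul1r.
rewrite /normalized_cdf qp !RintegralZl//; last exact: integrableS ip.
rewrite [X in _ / (_ * X)]/Rintegral p1/= mulr1 mulrAC divff ?mul1r//.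
by rewrite gt_eqF// invr_gt0.
Qed.

Lemma Rintegral_gt0 (R : realType) (D : set R) (q : R -> R) (a b : R) :
  measurable D -> lebesgue_measure.-integrable D (EFin \o q) ->
  (forall t, 0 <= q t) -> a < b -> `]a, b[ `<=` D ->
  (forall t, a < t < b -> 0 < q t) ->
  0 < \int[lebesgue_measure]_(t in D) q t.
Proof.
move=> mD iq q0 ab abD qp.
rewrite lt0r Rintegral_ge0 ?andbT//; apply/negP.
rewrite /Rintegral fine_eq0; last exact: integrable_fin_num.
move=> /eqP I0.
have {}I0 : (\int[lebesgue_measure]_(t in D) `|(q t)%:E| = 0)%E.
  by rewrite -[RHS]I0; apply: eq_integral => t _; rewrite gee0_abs ?lee_fin.
move/ae_eq_integral_abs : I0 => /(_ mD (measurable_int _ iq)) [Z [mZ Z0 sZ]].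
have abZ : `]a, b[ `<=` Z.
  move=> t /= tab; apply: sZ => /= /(_ (abD _ tab)) [] /eqP.
  by rewrite gt_eqF// qp//; rewrite in_itv/= in tab.
have : (lebesgue_measure (`]a, b[%classic : set R) <= lebesgue_measure Z)%E.
  by apply: le_measure; rewrite ?inE.
by rewrite lebesgue_measure_itv/= lte_fin ab Z0 -EFinB lee_fin subr_le0 leNgt ab.
Qed.

(** * The standardised chi-square density for many degrees of freedom *)

Lemma ndecr_gt0_derive (R : realType) (F dF : R -> R) :
  (forall w : R, 0 < w -> is_derive w (1 : R) F (dF w)) ->
  (forall w, 0 < w -> 0 <= dF w) ->
  forall a b, 0 < a -> a <= b -> F a <= F b.
Proof.
move=> dF_ dF0 a b a0 ab.
apply: (@ger0_derive1_ndecr _ F a b) => //.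
- move=> x; rewrite in_itv/= => /andP[ax _].
  by have [] := dF_ x (lt_trans a0 ax).
- move=> x; rewrite in_itv/= => /andP[ax _].
  have dx := dF_ x (lt_trans a0 ax).
  by rewrite derive1E derive_val dF0// (lt_trans a0).
- apply: within_continuous_gt0 => [x x0|x /=]; last first.
    by rewrite !in_itv/= andbT => /andP[+ _]; exact: lt_le_trans.
  apply: differentiable_continuous; apply/derivable1_diffP.
  by have [] := dF_ x x0.
Qed.

(** The derivative is (w - 1) ^ 2 / w. *)
Lemma ln_taylor2_ndecr (R : realType) (a b : R) : 0 < a -> a <= b ->
  ln a - (a - 1) + (a - 1) ^+ 2 / 2 <= ln b - (b - 1) + (b - 1) ^+ 2 / 2.
Proof.
apply: (@ndecr_gt0_derive _ (fun w => ln w - (w - 1) + (w - 1) ^+ 2 / 2)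
  (fun w => (w - 1) ^+ 2 / w)) => w w0; last by rewrite divr_ge0 ?sqr_ge0 ?ltW.
have dl := is_derive1_ln w0.
apply: is_derive_eq.
rewrite /GRing.scale/=; field; rewrite gt_eqF//.
Qed.

(** The derivative is (1 - 1 / w) ^ 2 / 2. *)
Lemma sub_ln_ndecr (R : realType) (a b : R) : 0 < a -> a <= b ->
  (a - a^-1) / 2 - ln a <= (b - b^-1) / 2 - ln b.
Proof.
apply: (@ndecr_gt0_derive _ (fun w => (w - w^-1) / 2 - ln w)
  (fun w => (1 - w^-1) ^+ 2 / 2)) => w w0; last by rewrite divr_ge0 ?sqr_ge0.
have dl := is_derive1_ln w0.
have w1 : w != 0 by rewrite gt_eqF.
have di : is_derive w (1 : R) (fun y : R => y^-1) (- w ^- 2 *: 1) by exact: (@is_deriveV R id w 1 1).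
apply: is_derive_eq.
rewrite /GRing.scale/=; field; rewrite gt_eqF//.
Qed.

(** Both bounds compare the values at 1 and at 1 + u of the monotone functions of
    [ln_taylor2_ndecr] and [sub_ln_ndecr].  They agree to second order in u; the
    upper one decays only linearly for large u, but is valid on the whole
    half-line, so that it serves both for the limit and for the domination. *)
Lemma ln1D_sandwich_ge0 (R : realType) (u : R) : 0 <= u ->
  - (u ^+ 2 / 2) <= ln (1 + u) - u <= - (u ^+ 2 / (2 * (1 + u))).
Proof.
move=> u0; have w1 : 1 <= 1 + u by rewrite lerDl.
have := ln_taylor2_ndecr _ _ _ ltr01 w1.
have := sub_ln_ndecr _ _ _ ltr01 w1.
have -> : (1 + u - (1 + u)^-1) / 2 = u - u ^+ 2 / (2 * (1 + u)).
  by field; lra.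
rewrite ln1 invr1 (_ : 1 + u - 1 = u); last by ring.
by move: (ln _) (u ^+ 2 / _) (u ^+ 2 / _) => l x y; lra.
Qed.

Lemma ln1D_sandwich_le0 (R : realType) (u : R) : -1 < u -> u <= 0 ->
  - (u ^+ 2 / (2 * (1 + u))) <= ln (1 + u) - u <= - (u ^+ 2 / 2).
Proof.
move=> u1 u0; have w1 : 1 + u <= 1 by lra.
have w0 : 0 < 1 + u by lra.
have := ln_taylor2_ndecr _ _ _ w0 w1.
have := sub_ln_ndecr _ _ _ w0 w1.
have -> : (1 + u - (1 + u)^-1) / 2 = u - u ^+ 2 / (2 * (1 + u)).
  by field; lra.
rewrite ln1 invr1 (_ : 1 + u - 1 = u); last by ring.
by move: (ln _) (u ^+ 2 / _) (u ^+ 2 / _) => l x y; lra.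
Qed.

(** The logarithm of (1 + s t) ^ (1 / s ^ 2 - 1) exp (- t / s), arranged so that
    ln (1 + s t) - s t, of order (s t) ^ 2, is isolated.  With s = sqrt (2 / f)
    this is the chi-square density at f + sqrt (2 f) t up to a factor free of t. *)
Definition gamma_exponent {R : realType} (s t : R) : R :=
  (s ^- 2 - 1) * (ln (1 + s * t) - s * t) - s * t.

Definition gamma_shape {R : realType} (s t : R) : R :=
  if 0 < 1 + s * t then expR (gamma_exponent s t) else 0.

(** Obtained from [ln1D_sandwich_ge0] at u = s t; both bounds tend to - t ^ 2 / 2
    as s tends to 0. *)
Lemma gamma_exponent_sandwich_ge0 (R : realType) (s t : R) :
  0 < s -> s <= 2^-1 -> 0 <= t ->
  - ((1 - s ^+ 2) * t ^+ 2 / 2) - s * t <= gamma_exponent s t <=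
  - ((1 - s ^+ 2) * t ^+ 2 / (2 * (1 + s * t))) - s * t.
Proof.
move=> s0 s1 t0; have u0 : 0 <= s * t by rewrite mulr_ge0// ltW.
have m0 : 0 <= s ^- 2 - 1 by rewrite subr_ge0 invf_ge1 ?exprn_gt0//; nra.
have /andP[lo hi] := ln1D_sandwich_ge0 _ _ u0.
rewrite /gamma_exponent !lerD2r.
have -> : (1 - s ^+ 2) * t ^+ 2 / 2 = (s ^- 2 - 1) * ((s * t) ^+ 2 / 2).
  by field; lra.
have -> : (1 - s ^+ 2) * t ^+ 2 / (2 * (1 + s * t)) =
    (s ^- 2 - 1) * ((s * t) ^+ 2 / (2 * (1 + s * t))).
  by field; lra.
by move: (ler_wpM2l m0 lo) (ler_wpM2l m0 hi); rewrite ![_ * - _]mulrN => -> ->.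
Qed.

Lemma gamma_exponent_sandwich_le0 (R : realType) (s t : R) :
  0 < s -> s <= 2^-1 -> 0 < 1 + s * t -> t <= 0 ->
  - ((1 - s ^+ 2) * t ^+ 2 / (2 * (1 + s * t))) - s * t <= gamma_exponent s t <=
  - ((1 - s ^+ 2) * t ^+ 2 / 2) - s * t.
Proof.
move=> s0 s1 w0 t0; have u0 : s * t <= 0 by nra.
have u1 : -1 < s * t by lra.
have m0 : 0 <= s ^- 2 - 1 by rewrite subr_ge0 invf_ge1 ?exprn_gt0//; nra.
have /andP[lo hi] := ln1D_sandwich_le0 _ _ u1 u0.
rewrite /gamma_exponent !lerD2r.
have -> : (1 - s ^+ 2) * t ^+ 2 / 2 = (s ^- 2 - 1) * ((s * t) ^+ 2 / 2).
  by field; lra.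
have -> : (1 - s ^+ 2) * t ^+ 2 / (2 * (1 + s * t)) =
    (s ^- 2 - 1) * ((s * t) ^+ 2 / (2 * (1 + s * t))).
  by field; lra.
by move: (ler_wpM2l m0 lo) (ler_wpM2l m0 hi); rewrite ![_ * - _]mulrN => -> ->.
Qed.

Lemma gamma_shape_ge0 (R : realType) (s t : R) : 0 <= gamma_shape s t.
Proof. by rewrite /gamma_shape; case: ifP => // _; exact: expR_ge0. Qed.

Lemma measurable_gamma_shape (R : realType) (s : R) :
  measurable_fun [set: R] (gamma_shape s).
Proof.
have mu : measurable_fun [set: R] (fun t : R => 1 + s * t).
  by apply: measurable_funD => //; exact: measurable_funM.
apply: measurable_fun_ifT => //; first exact: measurable_fun_ltr.
apply: measurableT_comp => //; apply: measurable_funB; last exact: measurable_funM.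
apply: measurable_funM => //; apply: measurable_funB; last exact: measurable_funM.
by apply: (@measurableT_comp _ _ _ _ _ _ (@ln R)) => //; exact: measurable_ln.
Qed.

(** At a fixed t the condition 0 < 1 + s t holds eventually, and the sandwich for
    the exponent gives the limit; which bound is the upper one depends on the
    sign of t. *)
Lemma gamma_shape_cvg (R : realType) (s : nat -> R) (t : R) :
  (forall n, 0 < s n) -> s n @[n --> \oo] --> 0 ->
  gamma_shape (s n) t @[n --> \oo] --> normal_fun 0 1 t.
Proof.
move=> s0 cs.
have cst1 (c : R) : (fun _ : nat => c) n @[n --> \oo] --> c by exact: cvg_cst.
have cu : 1 + s n * t @[n --> \oo] --> (1 : R).
  rewrite -[X in _ --> X]addr0 -(mul0r t).
  by apply: cvgD => //; apply: cvgM.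
have cnum : (1 - s n ^+ 2) * t ^+ 2 @[n --> \oo] --> t ^+ 2.
  rewrite -[X in _ --> X]mul1r; apply: cvgM => //.
  rewrite -[X in _ --> X]subr0; apply: cvgB => //.
  rewrite -[X in _ --> X](mulr0 (0 : R)); under eq_cvg do rewrite expr2.
  exact: cvgM.
have cst0 : s n * t @[n --> \oo] --> (0 : R).
  by rewrite -(mul0r t); apply: cvgM.
have c1 : - ((1 - s n ^+ 2) * t ^+ 2 / 2) - s n * t @[n --> \oo] --> - (t ^+ 2 / 2).
  rewrite -[X in _ --> X]subr0; apply: cvgB => //; apply: cvgN.
  by apply: cvgM => //.
have c2 : - ((1 - s n ^+ 2) * t ^+ 2 / (2 * (1 + s n * t))) - s n * t
    @[n --> \oo] --> - (t ^+ 2 / 2).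
  rewrite -[X in _ --> X]subr0; apply: cvgB => //; apply: cvgN.
  apply: cvgM => //; apply: cvgV => //.
  by rewrite -[X in _ --> X]mulr1; apply: cvgM.
have w0 : \forall n \near \oo, 0 < 1 + s n * t by exact: cvgr_gt cu _ ltr01.
have s1 : \forall n \near \oo, s n <= 2^-1 by apply: cvgr_le cs _ _.
have ce : gamma_exponent (s n) t @[n --> \oo] --> - (t ^+ 2 / 2).
  have [t0|/ltW t0] := leP 0 t.
    apply: squeeze_cvgr c1 c2; apply: filterS s1 => n s1.
    exact: gamma_exponent_sandwich_ge0.
  apply: squeeze_cvgr c2 c1; apply: filterS2 w0 s1 => n w0 s1.
  exact: gamma_exponent_sandwich_le0.
have -> : normal_fun 0 1 t = expR (- (t ^+ 2 / 2)).
  by rewrite /normal_fun subr0 expr1n mulNr.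
have : expR (gamma_exponent (s n) t) @[n --> \oo] --> expR (- (t ^+ 2 / 2)).
  by apply: (cvg_comp _ _ ce); exact: continuous_expR.
apply: cvg_trans; apply: near_eq_cvg.
by apply: filterS w0 => n w0; rewrite /gamma_shape w0.
Qed.

(** A normal tail on the left and an exponential one on the right, for the right
    tail of the standardised chi-square law is only exponential.  The constants
    turn the two densities into exp (1 - t ^ 2 / 8) and, for t >= 0, into
    exp (1 - t / 4); they bound the shape for s <= 1 / 2, where
    1 - s ^ 2 >= 3 / 4. *)
Definition gamma_shape_majorant {R : realType} (t : R) : R :=
  expR 1 / normal_peak 2 * normal_pdf 0 2 t +
  expR 1 * 4 * exponential_pdf 4^-1 t.

Lemma integrable_gamma_shape_majorant (R : realType) :
  lebesgue_measure.-integrable setT (EFin \o @gamma_shape_majorant R).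
Proof.
rewrite (_ : _ \o _ = ((fun t => (expR 1 / normal_peak 2)%:E *
    (normal_pdf 0 2 t)%:E) \+
  (fun t => (expR 1 * 4)%:E * (exponential_pdf (4^-1 : R) t)%:E))%E); last first.
  by apply/funext => t.
apply: integrableD => //; apply: integrableZl => //.
- exact: integrable_normal_pdf.
- exact: integrable_exponential_pdf.
Qed.

Lemma gamma_shape_le_majorant (R : realType) (s t : R) :
  0 < s -> s <= 2^-1 -> gamma_shape s t <= gamma_shape_majorant t.
Proof.
move=> s0 s1; rewrite /gamma_shape_majorant.
have pk : normal_peak (2 : R) != 0 by rewrite gt_eqF// normal_peak_gt0.
have -> : expR 1 / normal_peak 2 * normal_pdf 0 2 t = expR (1 - t ^+ 2 / 8).
  rewrite normal_pdfE// mulrA -(mulrA (expR 1)) mulVf// mulr1 -expRD.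
  by congr expR; rewrite subr0; field.
have en0 : 0 <= expR 1 * 4 * exponential_pdf (4^-1 : R) t.
  by rewrite !mulr_ge0// ?expR_ge0// exponential_pdf_ge0.
rewrite /gamma_shape; case: ifPn => w0; last by rewrite addr_ge0// expR_ge0.
have [t0|/ltW t0] := leP 0 t.
  rewrite ler_wpDl ?expR_ge0//.
  rewrite exponential_pdfE// mulrA -(mulrA _ 4) mulfV//.
  rewrite mulr1 -expRD ler_expR.
  have /andP[_ /le_trans->//] := gamma_exponent_sandwich_ge0 _ _ _ s0 s1 t0.
  rewrite -subr_ge0.
  have -> : 1 + - (4^-1) * t - (- ((1 - s ^+ 2) * t ^+ 2 / (2 * (1 + s * t))) - s * t)
    = ((4 - t + 4 * s * t) * (1 + s * t) + 2 * (1 - s ^+ 2) * t ^+ 2)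
      / (4 * (1 + s * t)) by field; lra.
  by rewrite divr_ge0//; nra.
rewrite ler_wpDr// ler_expR.
have /andP[_ /le_trans->//] := gamma_exponent_sandwich_le0 _ _ _ s0 s1 w0 t0.
have s2 : s ^+ 2 <= 4^-1 by nra.
have := mulr_ge0 (sqr_ge0 t) (_ : 0 <= 4^-1 - s ^+ 2); rewrite subr_ge0 => /(_ s2).
have := sqr_ge0 t; lra.
Qed.

(** * The distribution functions of K_f and of the normal law *)

(** The chi-square density without its normalising constant. *)
Definition chi_square_kernel {R : realType} (f : R) : R -> R :=
  (chi_square_fun f) \_ `]0, +oo[.

Lemma chi_square_kernel_ge0 (R : realType) (f y : R) :
  0 <= chi_square_kernel f y.
Proof.
by rewrite /chi_square_kernel patchE; case: ifP => // _; exact: chi_square_fun_ge0.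
Qed.

Lemma measurable_chi_square_kernel (R : realType) (f : R) :
  measurable_fun [set: R] (chi_square_kernel f).
Proof.
apply/(measurable_restrictT _ _).1 => //; apply: measurable_funTS.
exact: measurable_chi_square_fun.
Qed.

Lemma chi_square_kernel_gt0 (R : realType) (f y : R) :
  0 < y -> chi_square_kernel f y = chi_square_fun f y.
Proof. by move=> y0; rewrite /chi_square_kernel patchE mem_set//= in_itv/= y0. Qed.

Lemma chi_square_kernel_le0 (R : realType) (f y : R) :
  y <= 0 -> chi_square_kernel f y = 0.
Proof.
move=> y0; rewrite /chi_square_kernel patchE memNset//= in_itv/= andbT.
by apply/negP; rewrite -leNgt.
Qed.

Lemma integrable_chi_square_kernel (R : realType) (f : R) : 0 < f ->
  lebesgue_measure.-integrable setT (EFin \o chi_square_kernel f).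
Proof.
move=> f0; apply/integrableP; split.
  by apply/measurable_EFinP; exact: measurable_chi_square_kernel.
under eq_integral do rewrite gee0_abs ?lee_fin ?chi_square_kernel_ge0//.
have : (\int[lebesgue_measure]_(x in `]0%R, +oo[) (chi_square_fun f x)%:E < +oo)%E.
  by rewrite integral_chi_square_fun// ltry.
rewrite [X in (X < _)%E -> _]integral_mkcond; congr (_ < _)%E; apply: eq_integral => x _.
by rewrite patchE /= /chi_square_kernel [in RHS]patchE; case: ifP.
Qed.

Lemma chi_square_pdf_kernel (R : realType) (f y : R) : 0 < f ->
  chi_square_pdf f y = (2 `^ (f / 2) * Gamma (f / 2))^-1 * chi_square_kernel f y.
Proof.
move=> f0; rewrite /chi_square_pdf f0; have [y0|y0] := ltP 0 y.
  by rewrite chi_square_kernel_gt0// mulrC.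
by rewrite chi_square_kernel_le0// mulr0.
Qed.

Lemma chi_square_const_gt0 (R : realType) (f : R) : 0 < f ->
  0 < (2 `^ (f / 2) * Gamma (f / 2))^-1.
Proof.
by move=> f0; rewrite invr_gt0 mulr_gt0 ?powR_gt0// Gamma_gt0 ?divr_gt0.
Qed.

Definition std_chi_cdf {R : realType} (f x : R) : R :=
  fine (distribution (chi_square_prob f) (chi_standardize f) `]-oo, x]%classic).

Lemma chi_standardize_preimage (R : realType) (f x : R) : 0 < f ->
  chi_standardize f @^-1` `]-oo, x] =
  `]-oo, f + Num.sqrt (2 * f) * x]%classic.
Proof.
move=> f0; have b0 : 0 < Num.sqrt (2 * f) by rewrite sqrtr_gt0 mulr_gt0.
apply/seteqP; split => y /=; rewrite !in_itv/= /chi_standardize ler_pdivrMr//;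
by rewrite lerBlDl mulrC.
Qed.

(** This form is used for f near a finite limit, where the unscaled kernels have
    a common majorant while the standardised densities may be unbounded near
    the moving end point - sqrt (f / 2). *)
Lemma std_chi_cdf_kernel (R : realType) (f x : R) : 0 < f ->
  std_chi_cdf f x =
  normalized_cdf (chi_square_kernel f) (f + Num.sqrt (2 * f) * x).
Proof.
move=> f0; rewrite /std_chi_cdf /distribution /pushforward.
rewrite chi_standardize_preimage// /chi_square_prob.
apply: (@normalized_cdf_pdf R (chi_square_pdf f) _ _ _ _ (chi_square_const_gt0 _ _ f0)).
- by move=> t; exact: chi_square_pdf_kernel.
- exact: measurable_chi_square_kernel.
- exact: chi_square_kernel_ge0.
- exact: integral_chi_square_pdf.
Qed.

(** With s = sqrt (2 / f), the point f + sqrt (2 f) t is f (1 + s t) and f / 2 is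
    1 / s ^ 2. *)
Lemma chi_square_kernel_standardized (R : realType) (f t : R) : 0 < f ->
  chi_square_kernel f (f + Num.sqrt (2 * f) * t) =
  f `^ (f / 2 - 1) * expR (- (f / 2)) * gamma_shape (Num.sqrt (2 / f)) t.
Proof.
move=> f0; set s := Num.sqrt (2 / f).
have s2 : s ^+ 2 = 2 / f by rewrite sqr_sqrtr// divr_ge0// ltW.
have bs : Num.sqrt (2 * f) = f * s.
  have -> : 2 * f = f ^+ 2 * (2 / f) by field; rewrite gt_eqF.
  by rewrite sqrtrM ?sqr_ge0// sqrtr_sqr ger0_norm// ltW.
have -> : f + Num.sqrt (2 * f) * t = f * (1 + s * t) by rewrite bs; ring.
rewrite /gamma_shape; case: ifPn => [w0|]; last first.
  rewrite -leNgt => w0; rewrite mulr0 chi_square_kernel_le0//.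
  by rewrite pmulr_rle0.
rewrite chi_square_kernel_gt0 ?mulr_gt0// /chi_square_fun.
rewrite powRM ?ltW// -!mulrA; congr (_ * _).
rewrite [(1 + s * t) `^ _]/powR gt_eqF// -!expRD; congr expR.
rewrite /gamma_exponent s2.
by move: (ln _) => l; field; rewrite gt_eqF.
Qed.

(** This form is used for f tending to infinity. *)
Lemma std_chi_cdf_shape (R : realType) (f x : R) : 0 < f ->
  std_chi_cdf f x = normalized_cdf (gamma_shape (Num.sqrt (2 / f))) x.
Proof.
move=> f0; have b0 : 0 < Num.sqrt (2 * f) by rewrite sqrtr_gt0 mulr_gt0.
have mp : measurable_fun [set: R] (EFin \o chi_square_pdf f).
  by apply/measurable_EFinP; exact: measurable_chi_square_pdf.
have p0 y : (0 <= (EFin \o chi_square_pdf f) y)%E.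
  by rewrite lee_fin chi_square_pdf_ge0.
pose p t := Num.sqrt (2 * f) * chi_square_pdf f (f + Num.sqrt (2 * f) * t).
have mF : measurable_fun [set: R] (fun t : R => f + Num.sqrt (2 * f) * t).
  by apply: measurable_funD => //; exact: measurable_funM.
have intp (D : set R) : measurable D ->
    (\int[lebesgue_measure]_(y in D) (chi_square_pdf f y)%:E =
    \int[lebesgue_measure]_(t in [set t | D (f + Num.sqrt (2 * f) * t)%R]) (p t)%:E)%E.
  move=> mD; rewrite (ge0_integral_affine _ _ f _ (EFin \o chi_square_pdf f) b0)//.
  have mD' : measurable [set t | D (f + Num.sqrt (2 * f) * t)].
    by rewrite -[X in measurable X]setTI; exact: mF.
  rewrite -ge0_integralZl//.
  by apply: measurable_funTS; exact: (measurableT_comp mp mF).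
rewrite /std_chi_cdf /distribution /pushforward chi_standardize_preimage//.
rewrite [X in fine X = _](intp `]-oo, f + Num.sqrt (2 * f) * x]%classic (measurable_itv _)).

have -> : [set t | `]-oo, f + Num.sqrt (2 * f) * x]%classic
    (f + Num.sqrt (2 * f) * t)] = `]-oo, x]%classic.
  by apply/seteqP; split => t /=; rewrite !in_itv/= lerD2l ler_pM2l.
pose k := Num.sqrt (2 * f) * ((2 `^ (f / 2) * Gamma (f / 2))^-1 *
  (f `^ (f / 2 - 1) * expR (- (f / 2)))).
apply: (@normalized_cdf_pdf R p _ k).
- by move=> t; rewrite /p /k chi_square_pdf_kernel// chi_square_kernel_standardized// !mulrA.
- by rewrite !mulr_gt0 ?expR_gt0 ?powR_gt0// chi_square_const_gt0.
- exact: measurable_gamma_shape.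
- exact: gamma_shape_ge0.
- by rewrite -[RHS](@integral_chi_square_pdf R f) intp.
Qed.

Definition std_normal_cdf {R : realType} (x : R) : R :=
  normalized_cdf (normal_fun 0 1) x.

Lemma integrable_std_normal_fun (R : realType) :
  lebesgue_measure.-integrable setT (EFin \o @normal_fun R 0 1).
Proof.
have n1 : (1 : R) != 0 by [].
rewrite (_ : _ \o _ = (fun t => (normal_peak 1)^-1%:E * (normal_pdf 0 1 t)%:E)%E).
  by apply: integrableZl => //; exact: integrable_normal_pdf.
apply/funext => t /=; rewrite normal_pdfE// -EFinM mulrA mulVf ?mul1r//.
by rewrite gt_eqF// normal_peak_gt0.
Qed.

Lemma Rintegral_std_normal_fun_gt0 (R : realType) (D : set R) (x : R) :
  measurable D -> `]-oo, x] `<=` D ->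
  0 < \int[lebesgue_measure]_(t in D) normal_fun 0 1 t.
Proof.
move=> mD xD; apply: (@Rintegral_gt0 _ _ _ (x - 1) x) => //.
- by apply: integrableS (integrable_std_normal_fun R).
- by move=> t; exact: normal_fun_ge0.
- by rewrite ltrBlDr ltrDl.
- by move=> t /=; rewrite in_itv/= => /andP[_ tx]; apply: xD; rewrite /= in_itv/= ltW.
- by move=> t _; exact: expR_gt0.
Qed.

Lemma std_normal_cdf_gt0 (R : realType) (x : R) : 0 < std_normal_cdf x.
Proof.
by rewrite divr_gt0//; apply: (@Rintegral_std_normal_fun_gt0 _ _ x).
Qed.

Lemma normal_prob_std_normal_cdf (R : realType) (x : R) :
  normal_prob (0 : R) 1 `]-oo, x]%classic = (std_normal_cdf x)%:E.
Proof.
rewrite -[LHS]fineK; last exact: fin_num_measure.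
congr EFin; rewrite /normal_prob.
apply: (@normalized_cdf_pdf R (normal_pdf 0 1) (normal_fun 0 1) (normal_peak 1)).
- by move=> t; rewrite normal_pdfE.
- exact: normal_peak_gt0.
- exact: measurable_normal_fun.
- exact: normal_fun_ge0.
- exact: integral_normal_pdf.
Qed.

Lemma continuous_std_normal_cdf (R : realType) : continuous (@std_normal_cdf R).
Proof.
move=> x; apply/(@cvg_nbhsP R R^o) => u ux.
apply: (@cvg_normalized_cdf _ (fun=> normal_fun 0 1) _ (normal_fun 0 1)) => //.
- by move=> _; exact: measurable_normal_fun.
- exact: measurable_normal_fun.
- exact: integrable_std_normal_fun.
- by move=> t; exact: cvg_cst.
- by apply: nearW => n t; rewrite ger0_norm// normal_fun_ge0.
- by rewrite gt_eqF//; apply: (@Rintegral_std_normal_fun_gt0 _ _ x).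
Qed.

Lemma std_chi_cdf_cvg_normal (R : realType) (f : nat -> R) (x : R) :
  (forall n, 0 < f n) -> f n @[n --> \oo] --> +oo ->
  std_chi_cdf (f n) x @[n --> \oo] --> std_normal_cdf x.
Proof.
move=> f0 foo; under eq_cvg do rewrite std_chi_cdf_shape//.
pose s n := Num.sqrt (2 / f n).
have s0 n : 0 < s n by rewrite sqrtr_gt0 divr_gt0.
have c2 : 2 / f n @[n --> \oo] --> (0 : R).
  rewrite -[X in _ --> X](mulr0 (2 : R)); apply: cvgM; first exact: cvg_cst.
  by apply/gtr0_cvgV0 => //; exact: nearW.
have cs : s n @[n --> \oo] --> (0 : R).
  by rewrite -[X in _ --> X](@sqrtr0 R); apply: (cvg_comp _ _ c2);
    exact: sqrt_continuous.
apply: (@cvg_normalized_cdf _ (gamma_shape \o s) _ gamma_shape_majorant) => //.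
- by move=> n; exact: measurable_gamma_shape.
- exact: measurable_normal_fun.
- exact: integrable_gamma_shape_majorant.
- by move=> t; exact: gamma_shape_cvg.
- have : \forall n \near \oo, s n <= 2^-1 by apply: cvgr_le cs _ _.
  apply: filterS => n s1 t; rewrite ger0_norm ?gamma_shape_ge0//.
  exact: gamma_shape_le_majorant.
- exact: cvg_cst.
- by rewrite gt_eqF//; apply: (@Rintegral_std_normal_fun_gt0 _ _ x).
Qed.

(** The power y ^ (f / 2 - 1) is monotone in f for y >= 1 and antitone for y <= 1,
    so one of the two ends of the range of f bounds it. *)
Lemma chi_square_kernel_le (R : realType) (f M y : R) : 1 <= f -> f <= M ->
  chi_square_kernel f y <= chi_square_kernel 1 y + chi_square_kernel M y.
Proof.
move=> f1 fM; have [y0|y0] := ltP 0 y; last first.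
  by rewrite !chi_square_kernel_le0// addr0.
rewrite !chi_square_kernel_gt0// /chi_square_fun -mulrDl.
rewrite ler_pM2r ?expR_gt0//; have [y1|/ltW y1] := leP 1 y.
  by rewrite ler_wpDl ?powR_ge0// ler_powR//; lra.
by rewrite ler_wpDr ?powR_ge0// ger_powR ?y0//; lra.
Qed.

Lemma chi_square_kernel_cvg (R : realType) (f : nat -> R) (f0 y : R) :
  f n @[n --> \oo] --> f0 ->
  chi_square_kernel (f n) y @[n --> \oo] --> chi_square_kernel f0 y.
Proof.
move=> cf; have [y0|y0] := ltP 0 y; last first.
  by under eq_cvg do rewrite chi_square_kernel_le0//;
    rewrite chi_square_kernel_le0//; exact: cvg_cst.
under eq_cvg do rewrite chi_square_kernel_gt0//.
rewrite chi_square_kernel_gt0// /chi_square_fun /powR gt_eqF//.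
apply: cvgM; last exact: cvg_cst.
apply: (cvg_comp (fun n => (f n / 2 - 1) * ln y) expR); last exact: continuous_expR.
apply: cvgM; last exact: cvg_cst.
apply: cvgB; last exact: cvg_cst.
by apply: cvgM => //; exact: cvg_cst.
Qed.

Lemma Rintegral_chi_square_kernel_gt0 (R : realType) (D : set R) (f c : R) :
  0 < f -> measurable D -> 0 < c -> `]-oo, c] `<=` D ->
  0 < \int[lebesgue_measure]_(y in D) chi_square_kernel f y.
Proof.
move=> f0 mD c0 cD; apply: (@Rintegral_gt0 _ _ _ 0 c) => //.
- by apply: integrableS (integrable_chi_square_kernel _ _ f0).
- exact: chi_square_kernel_ge0.
- by move=> t /=; rewrite in_itv/= => /andP[_ tx]; apply: cD; rewrite /= in_itv/= ltW.
- move=> t /andP[t0 _]; rewrite chi_square_kernel_gt0//.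
  by rewrite mulr_gt0 ?powR_gt0 ?expR_gt0.
Qed.

Lemma std_chi_cdf_cvg (R : realType) (f : nat -> R) (f0 x : R) :
  1 <= f0 -> (\forall n \near \oo, 1 <= f n) -> f n @[n --> \oo] --> f0 ->
  std_chi_cdf (f n) x @[n --> \oo] --> std_chi_cdf f0 x.
Proof.
move=> f01 f1 cf; have f00 : 0 < f0 by rewrite (lt_le_trans ltr01).
have h : normalized_cdf (chi_square_kernel (f n)) (f n + Num.sqrt (2 * f n) * x)
    @[n --> \oo] --> std_chi_cdf f0 x.
  rewrite std_chi_cdf_kernel//.
  apply: (@cvg_normalized_cdf _ (fun n => chi_square_kernel (f n)) _
    (fun y => chi_square_kernel 1 y + chi_square_kernel (f0 + 1) y)).
  - by move=> n; exact: measurable_chi_square_kernel.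
  - exact: measurable_chi_square_kernel.
  - rewrite (_ : _ \o _ = (EFin \o chi_square_kernel 1) \+
      (EFin \o chi_square_kernel (f0 + 1)))%E; last by apply/funext.
    by apply: integrableD => //; apply: integrable_chi_square_kernel => //;
      rewrite addr_gt0.
  - by move=> t; exact: chi_square_kernel_cvg.
  - have : \forall n \near \oo, f n <= f0 + 1.
      by apply: cvgr_le cf _ _; rewrite ltrDl.
    apply: filterS2 f1 => n f1 fM t.
    by rewrite ger0_norm ?chi_square_kernel_ge0// chi_square_kernel_le.
  - apply: cvgD => //; apply: cvgM; last exact: cvg_cst.
    apply: (cvg_comp (fun n => 2 * f n) Num.sqrt); last exact: sqrt_continuous.
    by apply: cvgM => //; exact: cvg_cst.
  - by rewrite gt_eqF//; apply: (@Rintegral_chi_square_kernel_gt0 _ _ _ 1).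
apply: cvg_trans h; apply: near_eq_cvg; apply: filterS f1 => n f1.
by rewrite std_chi_cdf_kernel// (lt_le_trans ltr01).
Qed.

Lemma std_chi_cdf_gt0 (R : realType) (f x : R) :
  0 < f -> 0 < f + Num.sqrt (2 * f) * x -> 0 < std_chi_cdf f x.
Proof.
move=> f0 c0; rewrite std_chi_cdf_kernel// divr_gt0//;
exact: (@Rintegral_chi_square_kernel_gt0 _ _ _ _ f0 _ c0).
Qed.

Lemma std_chi_cdf_eq0 (R : realType) (f x : R) :
  0 < f -> f + Num.sqrt (2 * f) * x <= 0 -> std_chi_cdf f x = 0.
Proof.
move=> f0 c0; rewrite std_chi_cdf_kernel// /normalized_cdf.
rewrite (_ : \int[_]_(_ in _) _ = 0) ?mul0r//.
rewrite /Rintegral integral0_eq// => y /=; rewrite in_itv/= => yc.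
by rewrite chi_square_kernel_le0// (le_trans yc).
Qed.

(** * Limits of the distribution functions and of the degrees of freedom *)

(** The sign of this expression tells on which side of the left end point
    - sqrt (f / 2) of the support of K_f the point - sqrt (g / 2) lies. *)
Lemma std_chi_pointE (R : realType) (f g : R) : 0 < f -> 0 < g ->
  f + Num.sqrt (2 * f) * - Num.sqrt (g / 2) =
  Num.sqrt f * (Num.sqrt f - Num.sqrt g).
Proof.
move=> f0 g0; have f2 : 0 <= 2 * f by rewrite mulr_ge0// ltW.
rewrite mulrN -(sqrtrM _ f2) (_ : 2 * f * (g / 2) = f * g); last by field.
by rewrite mulrBr -expr2 sqr_sqrtr ?sqrtrM// ltW.
Qed.

Lemma std_chi_point_le0 (R : realType) (f g : R) : 0 < f -> 0 < g ->
  (f + Num.sqrt (2 * f) * - Num.sqrt (g / 2) <= 0) = (f <= g).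
Proof.
by move=> f0 g0; rewrite std_chi_pointE// pmulr_rle0 ?sqrtr_gt0// subr_le0 (ler_sqrt _ (ltW g0)).
Qed.

Lemma std_chi_point_lt0 (R : realType) (f g : R) : 0 < f -> 0 < g ->
  (f + Num.sqrt (2 * f) * - Num.sqrt (g / 2) < 0) = (f < g).
Proof.
by move=> f0 g0; rewrite std_chi_pointE// pmulr_rlt0 ?sqrtr_gt0// subr_lt0 ltr_sqrt.
Qed.

Lemma std_chi_cdf_pinfty (R : realType) (f : nat -> R) :
  (forall n, 1 <= f n) ->
  f n @[n --> \oo] --> +oo <->
  forall x, std_chi_cdf (f n) x @[n --> \oo] --> std_normal_cdf x.
Proof.
move=> f1; have f0 n : 0 < f n by rewrite (lt_le_trans ltr01).
split=> [foo x|h]; first exact: std_chi_cdf_cvg_normal.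
apply/cvgryPge => A; have A0 : 0 < Num.max A 1 by rewrite lt_max ltr01 orbT.
have : \forall n \near \oo,
    0 < std_chi_cdf (f n) (- Num.sqrt (Num.max A 1 / 2)).
  by apply: cvgr_gt (h _) _ _; exact: std_normal_cdf_gt0.
apply: filterS => n; apply: contraLR; rewrite -ltNge -leNgt => fA.
rewrite std_chi_cdf_eq0// std_chi_point_le0//.
by rewrite le_max ltW.
Qed.

(** A point strictly between the left end points of the supports of K_1 and of
    K_(1 + e): the law of K_1 gives no mass to its left, and those of the K_f
    with f >= 1 + e a mass bounded away from 0, by compactness. *)
Lemma std_chi_cdf_ge_away (R : realType) (e : R) : 0 < e ->
  exists x c : R, [/\ 1 + Num.sqrt (2 * 1) * x < 0, 0 < c &
    forall f, 1 + e <= f -> c <= std_chi_cdf f x].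
Proof.
move=> e0; have g0 : 0 < 1 + e / 2 by rewrite addr_gt0 ?divr_gt0.
pose x := - Num.sqrt ((1 + e / 2) / 2); exists x.
(* Truncating the parameter at 1 gives a function that is continuous on the
   whole line. *)
pose h (f : R) := std_chi_cdf (Num.max 1 f) x.
have max1 (f : R) : 1 <= Num.max 1 f by rewrite le_max lexx.
have ch : continuous h.
  move=> p; apply/(@cvg_nbhsP R R^o) => u up; apply: std_chi_cdf_cvg => //.
    exact: nearW.
  have cm : {for p, continuous ((cst 1 : R -> R^o) \max id)}.
    by apply: continuous_max; [exact: cvg_cst|exact: cvg_id].
  exact: (cvg_comp _ _ up cm).
have hoo : h f @[f --> +oo] --> std_normal_cdf x.
  apply/cvg_pinftyP => u uoo; apply: std_chi_cdf_cvg_normal.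
    by move=> n; rewrite (lt_le_trans ltr01).
  move/cvgryPge : uoo => uoo; apply/cvgryPge => A; apply: filterS (uoo A) => n Au.
  by rewrite le_max Au orbT.
have [M [_ Mh]] : \forall f \near +oo, std_normal_cdf x / 2 < h f.
  apply: cvgr_gt hoo _ _; have := std_normal_cdf_gt0 R x; lra.
have h0 f : 1 + e <= f -> 0 < h f.
  move=> ef; rewrite /h; have -> : Num.max 1 f = f by apply/max_idPr; lra.
  have f0 : 0 < f by lra.
  by apply: std_chi_cdf_gt0 => //; rewrite ltNge std_chi_point_le0// -ltNge; lra.
have eM : 1 + e <= Num.max (1 + e) (M + 1) by rewrite le_max lexx.
have [m me mh] := EVT_min eM (continuous_subspaceT ch).
exists (Num.min (h m) (std_normal_cdf x / 2)); split.
- by rewrite /x std_chi_point_lt0//; lra.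
- have hm : 0 < h m by apply: h0; move: me; rewrite in_itv/= => /andP[].
  by rewrite lt_min hm divr_gt0// std_normal_cdf_gt0.
- move=> f ef; have fh : std_chi_cdf f x = h f.
    by rewrite /h (_ : Num.max 1 f = f)//; apply/max_idPr; lra.
  rewrite fh ge_min; have [fM|Mf] := leP f (M + 1); apply/orP; [left|right].
    by apply: mh; rewrite in_itv/= ef le_max fM orbT.
  by apply/ltW/Mh; lra.
Qed.

(** Convergence is needed only at points below the support of K_1, which are
    continuity points of F_1. *)
Lemma std_chi_cdf_to1 (R : realType) (f : nat -> R) :
  (forall n, 1 <= f n) ->
  (forall x, 1 + Num.sqrt (2 * 1) * x < 0 ->
    std_chi_cdf (f n) x @[n --> \oo] --> std_chi_cdf 1 x) ->
  f n @[n --> \oo] --> (1 : R).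
Proof.
move=> f1 h; apply/cvgrPdist_lt => e e0.
have [x [c [x1 c0 hc]]] := std_chi_cdf_ge_away _ _ e0.
have := h x x1; rewrite std_chi_cdf_eq0 ?ltW// => h0.
have : \forall n \near \oo, std_chi_cdf (f n) x < c by exact: cvgr_lt h0 _ c0.
apply: filterS => n.
apply: contraLR; rewrite -!leNgt => ef; apply: hc.
move: ef; rewrite distrC ger0_norm ?subr_ge0//; lra.
Qed.

Lemma df_bounds (R : realType) (f b : R) :
  0 < b -> b <= 1 -> 1 <= f * b ^+ 2 -> f * b ^+ 6 <= 1 ->
  [/\ 1 <= f, f^-1 <= b & f <= (b ^+ 6)^-1].
Proof.
move=> b0 b1 fb2 fb6.
have f0 : 0 < f.
  by have := lt_le_trans ltr01 fb2; rewrite pmulr_lgt0// exprn_gt0.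
split.
- apply: le_trans fb2 _; rewrite ler_piMr ?(ltW f0)//.
  by rewrite exprn_ile1// ltW.
- rewrite -[leLHS]mul1r ler_pdivrMr// mulrC.
  apply: le_trans fb2 _; rewrite ler_pM2l// expr2.
  by rewrite ler_piMr ?(ltW b0).
- by rewrite -[leRHS]mul1r ler_pdivlMr ?exprn_gt0.
Qed.

Lemma df_pinfty (R : realType) (f b : nat -> R) :
  (forall n, 0 < b n) -> (forall n, 1 <= f n) ->
  (forall n, (f n)^-1 <= b n) -> (forall n, f n <= (b n ^+ 6)^-1) ->
  f n @[n --> \oo] --> +oo <-> b n @[n --> \oo] --> (0 : R).
Proof.
move=> b_gt0 f_ge1 fb bf; split=> [foo|b0].
  apply/cvgrPdist_lt => e e0; move/cvgryPgt : foo => /(_ (e ^+ 6)^-1).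
  apply: filterS => n fe; rewrite sub0r normrN gtr0_norm//.
  rewrite ltNge; apply/negP => eb.
  have := lt_le_trans fe (bf n); rewrite ltf_pV2 ?posrE ?exprn_gt0//.
  by rewrite ltNge lerXn2r// nnegrE ltW.
apply/cvgryPge => A; have A0 : 0 < Num.max A 1 by rewrite lt_max ltr01 orbT.
have : \forall n \near \oo, b n < (Num.max A 1)^-1.
  by apply: cvgr_lt b0 _ _; rewrite invr_gt0.
have f_gt0 n : 0 < f n by rewrite (lt_le_trans ltr01).
apply: filterS => n bA; have := le_lt_trans (fb n) bA.
by rewrite ltf_pV2 ?posrE// gt_max => /andP[/ltW].
Qed.

Lemma df_to1 (R : realType) (f b : nat -> R) :
  (forall n, b n <= 1) -> (forall n, 1 <= f n) ->
  (forall n, (f n)^-1 <= b n) -> (forall n, f n <= (b n ^+ 6)^-1) ->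
  f n @[n --> \oo] --> (1 : R) <-> b n @[n --> \oo] --> (1 : R).
Proof.
move=> b_le1 f_ge1 fb bf; split=> [f1|b1].
  have iv : (f n)^-1 @[n --> \oo] --> (1 : R).
    by rewrite -[X in _ --> X]invr1; apply: cvgV.
  apply: squeeze_cvgr iv (cvg_cst _); apply: nearW => n.
  by rewrite fb b_le1.
have ub : (b n ^+ 6)^-1 @[n --> \oo] --> (1 : R).
  rewrite -[X in _ --> X]invr1; apply: cvgV => //.
  rewrite -[X in _ --> X](expr1n R 6).
  by apply: (cvg_comp _ (fun x : R => x ^+ 6) b1); exact: exprn_continuous.
apply: squeeze_cvgr (cvg_cst _) ub; apply: nearW => n.
by rewrite f_ge1 bf.
Qed.

Lemma cdf_std_chi (R : realType) (d : measure_display) (T : measurableType d)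
    (P : probability T R) (X : {RV P >-> R}) (f : R)
    (K : {RV P >-> R} := chi_standardize f \o X) (x : R) :
  has_law X (chi_square_prob f) ->
  cdf K x = (std_chi_cdf f x)%:E.
Proof.
move=> lawX; rewrite /std_chi_cdf fineK; last exact: fin_num_measure.
rewrite /cdf /distribution /pushforward/= -lawX//.
by rewrite -[X in measurable X]setTI; exact: measurable_funP.
Qed.

(** The index is shifted because the laws are prescribed for positive N only. *)
Lemma cvg_in_distribution_real (R : realType) (disp : nat -> measure_display)
    (Omega : forall N, measurableType (disp N))
    (P : forall N, probability (Omega N) R) (K : forall N, {RV (P N) >-> R})
    (Q : set R -> \bar R) (F : nat -> R -> R) (G : R -> R) :
  (forall n x, cdf (K n.+1) x = (F n x)%:E) ->
  (forall x, Q `]-oo, x]%classic = (G x)%:E) ->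
  cvg_in_distribution K Q <->
  forall x, continuous_at x G -> F n x @[n --> \oo] --> G x.
Proof.
move=> KF QG.
have cG x : continuous_at x (fun y => Q `]-oo, y]%classic) <-> continuous_at x G.
  have -> : (fun y => Q `]-oo, y]%classic) = EFin \o G by apply/funext.
  split=> [/fine_cvgP[]//|cx]; apply: cvg_EFin => //; exact: nearW.
have e x : cdf (K n) x @[n --> \oo] --> Q `]-oo, x]%classic <->
    F n x @[n --> \oo] --> G x.
  rewrite QG -(cvg_shiftS (fun n => cdf (K n) x)).
  have -> : (fun n => cdf (K n.+1) x) = EFin \o (fun n => F n x).
    by apply/funext => m; exact: KF.
  split=> [/fine_cvgP[]//|cx]; apply: cvg_EFin => //; exact: nearW.
by split=> h x /cG/h/e.
Qed.

Theorem theorem3p3 (R : realType)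
    (a : nat -> nat)
    (d n : forall N : nat, 'I_(a N) -> nat)
    (Sigma : forall (N : nat) (i : 'I_(a N)), 'M[R]_(d N i))
    (T : forall N : nat, 'M[R]_(\sum_(i < a N) d N i))
    (lambda : nat -> seq R)
    (disp : nat -> measure_display)
    (Omega : forall N : nat, measurableType (disp N))
    (P : forall N : nat, probability (Omega N) R)
    (chi : forall N : nat, {RV (P N) >-> R}) :
  let V N := block_covariance N (n N) (Sigma N) in
  let f N := fP (T N) (V N) in
  let K N : {RV (P N) >-> R} := chi_standardize (f N) \o chi N in
  (forall N, (0 < N)%N ->
     (forall i, (0 < d N i)%N) /\ (forall i, (0 < n N i)%N) /\
     N = (\sum_(i < a N) n N i)%N) ->
  (forall N, (0 < N)%N -> forall i, posdefmx (Sigma N i)) ->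
  (forall N, (0 < N)%N ->
     T N != 0 /\ (T N)^T = T N /\ T N *m T N = T N) ->
  (forall N, (0 < N)%N ->
     ordered_eigenvalues (T N *m V N *m T N) (lambda N)) ->
  (forall N, (0 < N)%N -> has_law (chi N) (chi_square_prob (f N))) ->
  (cvg_in_distribution K (normal_prob 0 1) <->
     beta1 (lambda N) @[N --> \oo] --> (0 : R)) /\
  (cvg_in_distribution K (distribution (chi_square_prob 1) (chi_standardize 1))
     <-> beta1 (lambda N) @[N --> \oo] --> (1 : R)).
Proof.
move=> V f K hn hS hT hl hchi.
have bounds N : (0 < N)%N -> [/\ 0 < beta1 (lambda N), beta1 (lambda N) <= 1,
    1 <= f N * beta1 (lambda N) ^+ 2 & f N * beta1 (lambda N) ^+ 6 <= 1].
  move=> N0; have [T0 [sT TT]] := hT N N0; apply: fP_beta1_bounds => //.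
    by apply: posdefmx_block_covariance => //; [exact: (hn N N0).2.1|exact: hS].
  exact: hl.
pose g m := f m.+1; pose b m := beta1 (lambda m.+1).
have b0 m : 0 < b m by have [] := bounds m.+1 isT.
have b1 m : b m <= 1 by have [] := bounds m.+1 isT.
have gb m : [/\ 1 <= g m, (g m)^-1 <= b m & g m <= (b m ^+ 6)^-1].
  by apply: df_bounds; have [] := bounds m.+1 isT.
have g1 m : 1 <= g m by have [] := gb m.
have gb1 m : (g m)^-1 <= b m by have [] := gb m.
have gb6 m : g m <= (b m ^+ 6)^-1 by have [] := gb m.
have Kcdf m x : cdf (K m.+1) x = (std_chi_cdf (g m) x)%:E.
  by apply: cdf_std_chi; exact: hchi.
have beta_cvg (l : R) : beta1 (lambda N) @[N --> \oo] --> l <->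
    b m @[m --> \oo] --> l.
  by rewrite -(cvg_shiftS (fun N => beta1 (lambda N))).
split.
- apply: (iff_trans _ (iff_sym (beta_cvg _))).
  apply: (iff_trans _ (df_pinfty _ _ _ b0 g1 gb1 gb6)).
  apply: (iff_trans _ (iff_sym (std_chi_cdf_pinfty _ _ g1))).
  apply: (iff_trans (cvg_in_distribution_real _ _ _ _ _ _ _ _ Kcdf
    (@normal_prob_std_normal_cdf R))).
  split=> h x; last by move=> _; exact: h.
  by apply: h; exact: continuous_std_normal_cdf.
- apply: (iff_trans _ (iff_sym (beta_cvg _))).
  apply: (iff_trans _ (df_to1 _ _ _ b1 g1 gb1 gb6)).
  have Q1 x : distribution (chi_square_prob 1) (chi_standardize 1) `]-oo, x]%classic
      = (std_chi_cdf (1 : R) x)%:E.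
    by rewrite /std_chi_cdf fineK//; exact: fin_num_measure.
  apply: (iff_trans (cvg_in_distribution_real _ _ _ _ _ _ _ _ Kcdf Q1)).
  split=> [h|g1' x _]; last by apply: std_chi_cdf_cvg => //; exact: nearW.
  apply: std_chi_cdf_to1 => // x x1; apply: h.
  (* Below its support F_1 is locally constant, hence continuous. *)
  have lt0 : \forall y \near x, 1 + Num.sqrt (2 * 1) * y < 0.
    have cl : {for x, continuous (fun y : R => 1 + Num.sqrt (2 * 1) * y)}.
      by apply: cvgD; [exact: cvg_cst|apply: cvgM; [exact: cvg_cst|exact: cvg_id]].
    exact: cvgr_lt cl _ x1.
  have c0 : (fun=> std_chi_cdf 1 x : R) y @[y --> x] --> std_chi_cdf 1 x.
    exact: cvg_cst.
  apply: cvg_trans c0; apply: near_eq_cvg; apply: filterS lt0 => y y1.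
  by rewrite !std_chi_cdf_eq0// ltW.
Qed.
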